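(* Let $(\Omega,\mathscr{F},\mu)$ be a complete probability space, $K\subset L^{0}(\mu)$ absolutely convex, closed in probability and bounded in probability, and $E_K=\mathrm{span}(K)$. Let $\varphi:E_K\to(-\infty,\infty]$ be convex and proper. Let $\tau$ be a locally convex equicontinuous Köthe topology on $E_K$ with the Krein-Šmulian property which is $F$-regular. Then the following are equivalent: (1) $\varphi$ is lower semicontinuous with respect to $\tau$; (2) for every $f\in E_K$, \[ \varphi(f)=\sup_{g\in F}\left\{\int_\Omega fg\,d\mu-\varphi^{\ast}(g)\right\},\qquad\text{where }\varphi^{\ast}(g)=\sup_{h\in E_K}\left\{\int_\Omega hg\,d\mu-\varphi(h)\right\}; \] (3) $\varphi$ has the equicontinuous Fatou property.
   Context: $L^{0}(\mu)$ carries the topology of convergence in probability. The polar of $C\subset L^{0}(\mu)$ is $C^{\circ}=\{g\in L^{0}(\mu):\sup_{f\in C}\int_\Omega|fg|\,d\mu\leq1\}$; set $E'_K=\mathrm{span}(K^{\circ})$, paired with $E_K$ via $\langle f,g\rangle=\int_\Omega fg\,d\mu$; for $F\subset E'_K$, $\sigma(E_K,F)$ is the associated weak topology on $E_K$. A set or sequence is $K$-bounded if it is contained in $\lambda K$ for some $\lambda>0$. A convex proper $\varphi$ has the equicontinuous Fatou property if every $K$-bounded sequence $(f_n)$ converging in probability to $f\in E_K$ satisfies $\varphi(f)\leq\liminf_n\varphi(f_n)$. A topology $\tau$ on $E_K$ is an equicontinuous Köthe topology if $K$ is $\tau$-compact and $\tau$ restricted to $K$-bounded sets equals $\sigma(E_K,F)$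 for some $F\subset E'_K$ that is solid, separates the points of $E_K$, and contains a strictly positive element; $F$ is then said to induce $\tau$. Such $\tau$ has the Krein-Šmulian property if a convex set $C\subset E_K$ is $\tau$-closed iff $C\cap\lambda K$ is $\tau$-closed for each $\lambda>0$. When $\tau$ has the Krein-Šmulian property and is induced by $F$, each $g\in F$ gives a $\tau$-continuous functional $f\mapsto\int_\Omega fg\,d\mu$, yielding a natural map $F\to(E_K,\tau)^{\ast}$ (the topological dual); $\tau$ is $F$-regular if $F$ induces $\tau$ and this natural map is surjective. *)

(* Defs.v *)
From HB Require Import structures.
From mathcomp Require Import all_boot all_order all_algebra.
From mathcomp Require Import all_classical all_reals all_analysis.
From mathcomp Require Import measurable_realfun.
From mathcomp Require Import generic_quotient.
Set Implicit Arguments.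
Unset Strict Implicit.
Unset Printing Implicit Defensive.
Import Order.TTheory GRing.Theory Num.Theory.
Import numFieldNormedType.Exports.
Local Open Scope classical_set_scope.
Local Open Scope ring_scope.
Local Open Scope quotient_scope.

Section L0_space.
Context d (T : measurableType d) (R : realType) (mu : probability T R).

(* L^0(mu): measurable real functions modulo mu-a.e. equality (library quotient) *)
Definition L0 : Type := {mfun_ mu, T >-> R}.

Definition fn (f : L0) : T -> R := ((repr f : {mfun T >-> R}) : T -> R).

Definition L0_of (f : {mfun T >-> R}) : L0 := \pi_({mfun_ mu, T >-> R}) f.
Definition L0zero : L0 := L0_of 0.
Definition L0add (f g : L0) : L0 := L0_of (repr f + repr g).
Definition L0scale (a : R) (f : L0) : L0 := L0_of (a *: repr f).

Definition span (A : set L0) : set L0 :=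
  [set f | exists s : seq (R * L0), (forall p, p \in s -> A p.2) /\
     f = foldr (fun p acc => L0add (L0scale p.1 p.2) acc) L0zero s].

Definition scale_set (l : R) (A : set L0) : set L0 := [set L0scale l f | f in A].

Definition absolutely_convex (A : set L0) : Prop :=
  forall f g (a b : R), A f -> A g -> `|a| + `|b| <= 1 ->
    A (L0add (L0scale a f) (L0scale b g)).

Definition convex_set (A : set L0) : Prop :=
  forall f g (t : R), A f -> A g -> 0 <= t <= 1 ->
    A (L0add (L0scale t f) (L0scale (1 - t) g)).

Definition cvg_in_prob (u : nat -> L0) (f : L0) : Prop :=
  forall eps : R, 0 < eps ->
    (fun n => mu [set x | eps <= `|fn (u n) x - fn f x|]) @ \oo --> 0%E.

(* closed for the topology of convergence in probability (a metrizable
   topology, hence closedness = sequential closedness) *)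
Definition closed_in_prob (A : set L0) : Prop :=
  forall (u : nat -> L0) f, (forall n, A (u n)) -> cvg_in_prob u f -> A f.

Definition bounded_in_prob (A : set L0) : Prop :=
  forall eps : R, 0 < eps -> exists M : R,
    forall f, A f -> (mu [set x | (M < `|fn f x|)%R] <= eps%:E)%E.

Definition K_bounded (K B : set L0) : Prop :=
  exists l : R, 0 < l /\ B `<=` scale_set l K.

Definition pair (f g : L0) : R := Rintegral mu setT (fun x => fn f x * fn g x).

Definition polar (C : set L0) : set L0 :=
  [set g | forall f, C f -> (\int[mu]_x (`|fn f x * fn g x|)%:E <= 1)%E].

Definition EK (K : set L0) : set L0 := span K.
Definition EK' (K : set L0) : set L0 := span (polar K).

Definition is_topology_on (X : set L0) (tau : set (set L0)) : Prop :=
  [/\ tau X, (forall U, tau U -> U `<=` X),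
      (forall S : set (set L0), S `<=` tau -> tau (\bigcup_(U in S) U)) &
      (forall U V, tau U -> tau V -> tau (U `&` V))].

Definition closed_in (tau : set (set L0)) (X C : set L0) : Prop :=
  C `<=` X /\ tau (X `\` C).

Definition compact_in (tau : set (set L0)) (A : set L0) : Prop :=
  forall S : set (set L0), S `<=` tau -> A `<=` \bigcup_(U in S) U ->
    exists S' : set (set L0),
      [/\ finite_set S', S' `<=` S & A `<=` \bigcup_(U in S') U].

Definition trace (tau : set (set L0)) (B : set L0) : set (set L0) :=
  [set U `&` B | U in tau].

Definition locally_convex_on (X : set L0) (tau : set (set L0)) : Prop :=
  [/\ (forall f g W, X f -> X g -> tau W -> W (L0add f g) ->
         exists U V, [/\ tau U, tau V, U f, V g &
                        forall u v, U u -> V v -> W (L0add u v)]),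
      (forall (a : R) f W, X f -> tau W -> W (L0scale a f) ->
         exists (del : R) U, [/\ 0 < del, tau U, U f &
            forall (b : R) u, `|b - a| < del -> U u -> W (L0scale b u)]) &
      (forall W, tau W -> W L0zero ->
         exists U, [/\ tau U, U L0zero, U `<=` W & convex_set U])].

Definition weak_top (X F : set L0) : set (set L0) :=
  [set U | U `<=` X /\ forall f, U f -> exists (s : seq L0) (eps : R),
     [/\ (forall g, g \in s -> F g), 0 < eps &
        [set h | X h /\ forall g, g \in s -> `|pair h g - pair f g| < eps]
          `<=` U]].

Definition solid_in (Y F : set L0) : Prop :=
  forall g h, F g -> Y h -> {ae mu, forall x, `|fn h x| <= `|fn g x|} -> F h.

Definition separates (X F : set L0) : Prop :=
  forall f f', X f -> X f' -> f <> f' -> exists g, F g /\ pair f g <> pair f' g.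

Definition has_strictly_positive (F : set L0) : Prop :=
  exists g, F g /\ {ae mu, forall x, 0 < fn g x}.

Definition induces (K : set L0) (F : set L0) (tau : set (set L0)) : Prop :=
  [/\ F `<=` EK' K, solid_in (EK' K) F, separates (EK K) F,
      has_strictly_positive F &
      forall B, K_bounded K B -> trace tau B = trace (weak_top (EK K) F) B].

Definition equicontinuous_Koethe (K : set L0) (tau : set (set L0)) : Prop :=
  compact_in tau K /\ exists F, induces K F tau.

Definition Krein_Smulian (K : set L0) (tau : set (set L0)) : Prop :=
  forall C, C `<=` EK K -> convex_set C ->
    (closed_in tau (EK K) C <->
     forall l : R, 0 < l -> closed_in tau (EK K) (C `&` scale_set l K)).

Definition linear_on (X : set L0) (ell : L0 -> R) : Prop :=
  forall f g (a b : R), X f -> X g ->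
    ell (L0add (L0scale a f) (L0scale b g)) = a * ell f + b * ell g.

Definition continuous_on (tau : set (set L0)) (X : set L0) (ell : L0 -> R) :=
  forall V : set R, open V -> tau (X `&` ell @^-1` V).

Definition F_regular (K F : set L0) (tau : set (set L0)) : Prop :=
  induces K F tau /\
  forall ell : L0 -> R, linear_on (EK K) ell -> continuous_on tau (EK K) ell ->
    exists g, F g /\ forall f, EK K f -> ell f = pair f g.

Definition convex_fun_on (X : set L0) (phi : L0 -> \bar R) : Prop :=
  forall f g (t : R), X f -> X g -> 0 < t < 1 ->
    (phi (L0add (L0scale t f) (L0scale (1 - t) g))
       <= t%:E * phi f + (1 - t)%:E * phi g)%E.

Definition proper_on (X : set L0) (phi : L0 -> \bar R) : Prop :=
  (forall f, X f -> phi f != -oo%E) /\ exists f, X f /\ (phi f < +oo)%E.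

Definition lsc_on (tau : set (set L0)) (X : set L0) (phi : L0 -> \bar R) :=
  forall r : R, closed_in tau X [set f | X f /\ (phi f <= r%:E)%E].

Definition conjugate (X : set L0) (phi : L0 -> \bar R) (g : L0) : \bar R :=
  ereal_sup [set ((pair h g)%:E - phi h)%E | h in X].

Definition equicontinuous_Fatou (K : set L0) (phi : L0 -> \bar R) : Prop :=
  forall (u : nat -> L0) f, K_bounded K (range u) -> EK K f -> cvg_in_prob u f ->
    (phi f <= limn_einf (fun n => phi (u n)))%E.

End L0_space.

(* Main.v *)
Require Import Defs.
From HB Require Import structures.
From mathcomp Require Import all_boot all_order all_algebra.
From mathcomp Require Import all_classical all_reals all_analysis.
From mathcomp Require Import measurable_realfun generic_quotient.
From mathcomp Require Import lra ring.
Set Implicit Arguments.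
Unset Strict Implicit.
Unset Printing Implicit Defensive.
Import Order.TTheory GRing.Theory Num.Theory.
Import numFieldNormedType.Exports.
Local Open Scope classical_set_scope.
Local Open Scope ring_scope.

(** (1) => (2): given [r < phi f0], the infimal convolution of [phi] with a large
    multiple of the gauge of a small convex neighbourhood of 0 is a finite convex
    minorant of [phi] with value at least [r] at [f0]; Hahn-Banach gives it a
    continuous subgradient there, which lies in [F] by regularity.

    (2) => (3): for [g] in [F], [pair _ g] is continuous along [K]-bounded
    sequences converging in probability. A cluster point of such a sequence for
    [sigma(E_K, F)] exists by compactness, and it agrees with the limit in
    probability on each set where a fast subsequence converges uniformly, since
    [F] is solid.

    (3) => (1): by Krein-Smulian it suffices that a convex subset [A] of [l K]
    which is closed in probability is closed for [sigma(E_K, F)]. Given [x], the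
    functional [h |-> int psi(h - x) W] with [psi t = sqrt (1 + t^2)] and a weight
    [W > 0] in [F] attains its minimum on [A]: strict convexity makes minimizing
    sequences Cauchy in probability. At a minimizer [h] the bounded function
    [psi'(h - x)], multiplied by [W], is in [F] by solidity and separates [x]
    from [A] unless [x = h]. *)

Lemma filterS5 T (F : set_system T) (FF : Filter F) (P Q S U W V : set T) :
  (forall x, P x -> Q x -> S x -> U x -> W x -> V x) ->
  F P -> F Q -> F S -> F U -> F W -> F V.
Proof.
move=> H FP FQ FS FU; apply: filterS3 (filterI FP FQ) (filterI FS FU).
by move=> x [? ?] [? ?]; exact: H.
Qed.

(** * The real vector space structure of [L0] *)

Lemma filterS4 T (F : set_system T) (FF : Filter F) (P Q S U V : set T) :
  (forall x, P x -> Q x -> S x -> U x -> V x) ->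
  F P -> F Q -> F S -> F U -> F V.
Proof.
move=> H FP FQ FS; apply: filterS3 (filterI FP FQ) FS.
by move=> x [? ?]; exact: H.
Qed.

Section L0_lmodule.
Local Open Scope quotient_scope.
Context d (T : measurableType d) (R : realType) (mu : probability T R).
Local Notation L0 := (L0 mu).

Lemma fn_measurable (f : L0) : measurable_fun setT (fn f).
Proof. exact: measurable_funP. Qed.

(** [fn] evaluates a representative picked by the quotient, so the class of [f] gives back [f] only
    up to a null set. All pointwise identities below are therefore almost everywhere statements. *)
Lemma fn_of (f : {mfun T >-> R}) : {ae mu, forall x, fn (L0_of mu f) x = f x}.
Proof.
have /eqmodP /asboolP : (repr (L0_of mu f) = f %[mod L0]).
  by rewrite reprK.
by apply: filterS => x; exact.
Qed.

Lemma eq_L0_ae (f g : L0) : {ae mu, forall x, fn f x = fn g x} -> f = g.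
Proof.
move=> h; rewrite -[f]reprK -[g]reprK; apply/eqmodP/asboolP.
by apply: filterS h => x + _; exact.
Qed.

Lemma L0_ofP (f : T -> R) : measurable_fun setT f ->
  exists g : L0, {ae mu, forall x, fn g x = f x}.
Proof.
move=> mf; have [g gE] : exists g : {mfun T >-> R}, f = g.
  have H := isMeasurableFun.Build _ _ _ _ f mf.
  by exists (HB.pack f H : {mfun T >-> R}).
by exists (L0_of mu g); rewrite gE; exact: fn_of.
Qed.

Lemma fn_add (f g : L0) :
  {ae mu, forall x, fn (L0add f g) x = fn f x + fn g x}.
Proof. exact: fn_of. Qed.

Lemma fn_scale a (f : L0) : {ae mu, forall x, fn (L0scale a f) x = a * fn f x}.
Proof. exact: fn_of. Qed.

Lemma fn_zero : {ae mu, forall x, fn (L0zero mu) x = 0}.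
Proof. exact: fn_of. Qed.

Definition L0opp (f : L0) := L0scale (-1) f.

Fact L0addA : associative (@L0add d T R mu).
Proof.
move=> f g h; apply: eq_L0_ae.
have := fn_add f (L0add g h); have := fn_add (L0add f g) h.
have := fn_add f g; have := fn_add g h.
by apply: filterS4 => x -> -> -> ->; lra.
Qed.

Fact L0addC : commutative (@L0add d T R mu).
Proof.
move=> f g; apply: eq_L0_ae; have := fn_add f g; have := fn_add g f.
by apply: filterS2 => x -> ->; lra.
Qed.

Fact L0add0 : left_id (L0zero mu) (@L0add d T R mu).
Proof.
move=> f; apply: eq_L0_ae; have := fn_add (L0zero mu) f; have := fn_zero.
by apply: filterS2 => x + ->; lra.
Qed.

Fact L0addN : left_inverse (L0zero mu) L0opp (@L0add d T R mu).
Proof.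
move=> f; apply: eq_L0_ae; have := fn_add (L0opp f) f; have := fn_zero.
have := fn_scale (-1) f; rewrite -/(L0opp f).
by apply: filterS3 => x + + ->; lra.
Qed.

HB.instance Definition _ := Choice.on L0.
HB.instance Definition _ :=
  GRing.isZmodule.Build L0 L0addA L0addC L0add0 L0addN.

Fact L0scaleA a b (f : L0) : L0scale a (L0scale b f) = L0scale (a * b) f.
Proof.
apply: eq_L0_ae; have := fn_scale a (L0scale b f); have := fn_scale b f.
have := fn_scale (a * b) f.
by apply: filterS3 => x -> -> ->; lra.
Qed.

Fact L0scale1 : left_id 1 (@L0scale d T R mu).
Proof.
move=> f; apply: eq_L0_ae; have := fn_scale 1 f.
by apply: filterS => x ->; lra.
Qed.

Fact L0scaleDr : right_distributive (@L0scale d T R mu) +%R.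
Proof.
move=> a f g; apply: eq_L0_ae; have := fn_add f g.
have := fn_scale a (L0add f g); have := fn_scale a f; have := fn_scale a g.
have := fn_add (L0scale a f) (L0scale a g).
move=> h1 h2 h3; apply: filterS5 h1 h2 h3.
by move=> x E1 E2 E3 E4 E5; rewrite [LHS]E4 [RHS]E1 E2 E3 E5; lra.
Qed.

Fact L0scaleDl (f : L0) : {morph (@L0scale d T R mu)^~ f : a b / a + b}.
Proof.
move=> a b; apply: eq_L0_ae; have := fn_add (L0scale a f) (L0scale b f).
have := fn_scale a f; have := fn_scale b f; have := fn_scale (a + b) f.
by apply: filterS4 => x E1 E2 E3 E4; rewrite [LHS]E1 [RHS]E4 E2 E3; lra.
Qed.

HB.instance Definition _ :=
  GRing.Zmodule_isLmodule.Build R L0 L0scaleA L0scale1 L0scaleDr L0scaleDl.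

Lemma L0addE (f g : L0) : L0add f g = f + g. Proof. by []. Qed.
Lemma L0scaleE a (f : L0) : L0scale a f = a *: f. Proof. by []. Qed.
Lemma L0zeroE : L0zero mu = 0. Proof. by []. Qed.

Lemma fnD (f g : L0) : {ae mu, forall x, fn (f + g) x = fn f x + fn g x}.
Proof. exact: fn_add. Qed.

Lemma fnZ a (f : L0) : {ae mu, forall x, fn (a *: f) x = a * fn f x}.
Proof. exact: fn_scale. Qed.

Lemma fnB (f g : L0) : {ae mu, forall x, fn (f - g) x = fn f x - fn g x}.
Proof.
have := fnD f (- g); have : {ae mu, forall x, fn (- g) x = -1 * fn g x}.
  exact: fn_scale.
by apply: filterS2 => x -> ->; lra.
Qed.

End L0_lmodule.

(** * A Hahn-Banach theorem with convex majorant *)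

Section Hahn_Banach.
Context (R : realType) (V : lmodType R).
Implicit Types (X : set V) (G : set (V * R)).

Definition linear_subspace X :=
  X 0 /\ forall a x y, X x -> X y -> X (a *: x + y).

Definition convex_real_on X (p : V -> R) := forall x y t, X x -> X y ->
  0 < t < 1 -> p (t *: x + (1 - t) *: y) <= t * p x + (1 - t) * p y.

(* Partial linear functionals are handled through their graphs, so that unions
   of chains are plain unions; single-valuedness follows from domination. *)
Definition dominated_graph X (p : V -> R) G :=
  (forall a x y r s, G (x, r) -> G (y, s) -> G (a *: x + y, a * r + s)) /\
  (forall x r, G (x, r) -> X x /\ r <= p x).

(** An admissible value [c] at [x0] must lie above all slopes coming from the side [- x0] and below
    all those coming from the side [x0]. Convexity of [p] puts the first family below the second,
    and [c] is the supremum of the first. *)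
Lemma dominated_graph_extend X p G x0 : linear_subspace X -> convex_real_on X p ->
  dominated_graph X p G -> G (0, 0) -> X x0 ->
  exists c, dominated_graph X p
    [set z | exists x r t, G (x, r) /\ z = (x + t *: x0, r + t * c)].
Proof.
move=> [X0 XL] cp [GL Gp] G0 Xx0.
have XD x t : X x -> X (x + t *: x0) by move=> ?; rewrite addrC; exact: XL.
(* The weight [k = s / (s + t)] makes the [x0] components of [x + t *: x0] and [x' - s *: x0]
   cancel. The combination lies in the domain of [G], where [p] dominates. *)
have key x r x' r' s t : G (x, r) -> G (x', r') -> 0 < s -> 0 < t ->
    (r' - p (x' - s *: x0)) / s <= (p (x + t *: x0) - r) / t.
  move=> Gx Gx' s0 t0.
  rewrite ler_pdivrMr// mulrAC ler_pdivlMr//.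
  have st0 : 0 < s + t by exact: addr_gt0.
  pose k := s / (s + t).
  have k1 : 1 - k = t / (s + t) by rewrite /k; field; exact: lt0r_neq0.
  have k01 : 0 < k < 1.
    by rewrite divr_gt0//= ltr_pdivrMr// mul1r ltrDl.
  have [Xx _] := Gp _ _ Gx; have [Xx' _] := Gp _ _ Gx'.
  have := cp _ _ k (XD x t Xx) (XD x' (- s) Xx') k01.
  have -> : k *: (x + t *: x0) + (1 - k) *: (x' + - s *: x0)
    = k *: x + ((1 - k) *: x' + 0).
    rewrite !scalerDr !scalerA k1 addr0 addrACA -scalerDl /k.
    rewrite (_ : s / (s + t) * t + t / (s + t) * - s = 0) ?scale0r ?addr0//.
    by field; exact: lt0r_neq0.
  have G2 := GL k _ _ _ _ Gx (GL (1 - k) _ _ _ _ Gx' G0).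
  have [_ /le_trans H] := Gp _ _ G2 => /H.
  rewrite addr0 k1 /k scaleNr.
  set A := p _; set B := p _ => h.
  have : (s + t) * (s / (s + t) * r + t / (s + t) * r') <=
         (s + t) * (s / (s + t) * A + t / (s + t) * B).
    by rewrite ler_pM2l.
  have E a b : (s + t) * (s / (s + t) * a + t / (s + t) * b) = s * a + t * b.
    by field; exact: lt0r_neq0.
  by rewrite !E; nra.
pose L := [set v | exists x r s, [/\ G (x, r), 0 < s &
  v = (r - p (x - s *: x0)) / s]].
have L0 : L !=set0 by exists ((0 - p (0 - 1 *: x0)) / 1); exists 0, 0, 1.
have Lub x r t : G (x, r) -> 0 < t -> ubound L ((p (x + t *: x0) - r) / t).
  by move=> Gx t0 _ [x' [r' [s [Gx' s0 ->]]]]; exact: key.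
have supL : has_sup L.
  by split=> //; exists ((p (0 + 1 *: x0) - 0) / 1); exact: Lub.
exists (sup L); split.
  move=> a _ _ _ _ [x [r [t [Gx [-> ->]]]]] [y [s [u [Gy [-> ->]]]]].
  exists (a *: x + y), (a * r + s), (a * t + u); split; first exact: GL.
  congr (_, _); last by ring.
  by rewrite scalerDr scalerDl scalerA addrACA.
move=> _ _ [x [r [t [Gx [-> ->]]]]]; have [Xx rp] := Gp _ _ Gx.
split; first exact: XD.
have [t0|t0|<-] := ltgtP 0 t; last by rewrite scale0r mul0r !addr0.
- have := ge_sup L0 (Lub _ _ _ Gx t0); rewrite ler_pdivlMr//; lra.
- have : (r - p (x - (- t) *: x0)) / (- t) <= sup L.
    by apply: sup_upper_bound => //; exists x, r, (- t); rewrite oppr_gt0.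
  by rewrite scaleNr opprK ler_pdivrMr ?oppr_gt0//; lra.
Qed.

Lemma Hahn_Banach X p : linear_subspace X -> convex_real_on X p -> 0 <= p 0 ->
  exists l : V -> R,
    (forall a x y, X x -> X y -> l (a *: x + y) = a * l x + l y) /\
    (forall x, X x -> l x <= p x).
Proof.
move=> sX cp p0.
have [G [dG maxG]] : exists G, dominated_graph X p G /\
    forall H, G `<` H -> ~ dominated_graph X p H.
  apply: (Zorn_bigcup (P := dominated_graph X p)) => S Sd tot; split.
    move=> a x y r s [A SA Ax] [B SB By].
    have [AB|BA] := tot _ _ SA SB.
      by exists B => //; apply: (Sd _ SB).1 => //; exact: AB.
    by exists A => //; apply: (Sd _ SA).1 => //; exact: BA.
  by move=> x r [A SA]; apply: (Sd _ SA).2.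
(* The empty graph is vacuously dominated, so a maximal graph must be shown to be inhabited: the
   graph reduced to the origin is dominated because [0 <= p 0]. *)
have G0 : G (0, 0).
  have [[[x r] Gx]|/forallNP Ge] := pselect (exists z, G z).
    have := dG.1 (-1) _ _ _ _ Gx Gx.
    by rewrite scaleN1r addNr mulN1r addNr.
  exfalso; apply: (maxG [set (0, 0)]).
    by split=> [z /Ge//|H]; apply: (Ge (0, 0)); exact: H.
  split=> [a x y r s [-> ->] [-> ->]|x r [-> ->]]; last by split=> //; case: sX.
  by rewrite /= scaler0 addr0 mulr0 addr0.
(* A nonzero value at 0 could be rescaled to [p 0 + 1], against domination. *)
have G00 r : G (0, r) -> r = 0.
  move=> Gr; apply/eqP/negPn/negP => r0.
  have := dG.1 ((p 0 + 1) / r) _ _ _ _ Gr G0.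
  rewrite scaler0 !addr0 divfK// => /dG.2 [_]; lra.
have tot x : X x -> exists r, G (x, r).
  move=> Xx; apply: contrapT => nx.
  have [c dc] := dominated_graph_extend sX cp dG G0 Xx.
  apply: maxG dc; split.
    by move=> [y r] Gy; exists y, r, 0; rewrite scale0r mul0r !addr0.
move=> sub; apply: nx; exists c; apply: sub.
  by exists 0, 0, 1; rewrite scale1r !add0r mul1r.
have uniq x r s : G (x, r) -> G (x, s) -> r = s.
  move=> Gr Gs; have := dG.1 (-1) _ _ _ _ Gr Gs.
  by rewrite scaleN1r addNr mulN1r => /G00; lra.
have /choice[l lP] : forall x, exists r, X x -> G (x, r).
  move=> x; have [Xx|nXx] := pselect (X x); last by exists 0.
  by have [r Gr] := tot _ Xx; exists r.
exists l; split=> [a x y Xx Xy|x Xx]; last exact: (dG.2 _ _ (lP _ Xx)).2.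
apply: uniq; first by apply: lP; apply: sX.2.
by apply: dG.1; exact: lP.
Qed.

End Hahn_Banach.

(** * The function [sqrt (1 + t ^ 2)] *)

Section pseudo_huber.
Context (R : realType).
Implicit Types a b t : R.

(** The pseudo-Huber function. Linear growth makes its weighted integrals finite, its bounded
    derivative [dphub] multiplies the weight without leaving a solid set, and its strict convexity
    is uniform on bounded intervals. *)
Definition phub t : R := Num.sqrt (1 + t ^+ 2).
Definition dphub t : R := t / phub t.

Lemma phub_sqr t : phub t ^+ 2 = 1 + t ^+ 2.
Proof. by rewrite sqr_sqrtr// addr_ge0// sqr_ge0. Qed.

Lemma phub_ge1 t : 1 <= phub t.
Proof.
rewrite -[leLHS]sqrtr1 ler_sqrt ?lerDl ?sqr_ge0//.
by rewrite addr_ge0// sqr_ge0.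
Qed.

Lemma phub_gt0 t : 0 < phub t.
Proof. exact: lt_le_trans (phub_ge1 t). Qed.

Lemma phub_ge0 t : 0 <= phub t. Proof. exact/ltW/phub_gt0. Qed.

Lemma normr_le_phub t : `|t| <= phub t.
Proof.
rewrite -ler_sqr ?nnegrE ?phub_ge0// phub_sqr real_normK ?num_real//.
by rewrite lerDr.
Qed.

Lemma phub_le t : phub t <= 1 + `|t|.
Proof.
rewrite -ler_sqr ?nnegrE ?phub_ge0 ?addr_ge0// phub_sqr.
rewrite -(real_normK (num_real t)); have := normr_ge0 t; nra.
Qed.

Lemma normr_dphub_le1 t : `|dphub t| <= 1.
Proof.
rewrite normrM normfV (gtr0_norm (phub_gt0 t)).
by rewrite ler_pdivrMr ?phub_gt0// mul1r normr_le_phub.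
Qed.

Lemma dphubM_ge0 t : 0 <= dphub t * t.
Proof. by rewrite mulrAC -expr2 divr_ge0 ?sqr_ge0 ?phub_ge0. Qed.

Lemma dphubM_eq0 t : dphub t * t = 0 -> t = 0.
Proof.
rewrite mulrAC -expr2 => /eqP; rewrite mulf_eq0 sqrf_eq0.
by rewrite invr_eq0 (gt_eqF (phub_gt0 t)) orbF => /eqP.
Qed.

(** Multiplied by [phub a], the inequality becomes [1 + a * b <= phub a * phub b], which is
    Cauchy-Schwarz for the vectors [(1, a)] and [(1, b)]. *)
Lemma phub_subgradient a b : phub a + dphub a * (b - a) <= phub b.
Proof.
have a0 := phub_gt0 a; have b0 := phub_gt0 b.
have := phub_sqr a; have := phub_sqr b.
rewrite /dphub -(ler_pM2l a0) mulrDr mulrA mulrCA divff ?gt_eqF// mulr1.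
set A := phub a in a0 *; set B := phub b in b0 * => EB EA.
have : (1 + a * b) ^+ 2 <= (A * B) ^+ 2.
  rewrite exprMn EA EB -subr_ge0.
  by rewrite (_ : _ - _ = (a - b) ^+ 2) ?sqr_ge0//; ring.
have AB0 : 0 <= A * B by rewrite mulr_ge0 ?ltW.
move=> h; have : 1 + a * b <= A * B.
  rewrite leNgt; apply/negP => lt1; move: h; rewrite leNgt => /negP; apply.
  by rewrite ltr_sqr// ?nnegrE//; apply: le_trans AB0 (ltW lt1).
by rewrite -expr2 EA; lra.
Qed.

(** Two differences of squares are chained: [D1] turns the gap [a - b] into a defect in
    Cauchy-Schwarz, and [D2] turns that defect into a defect in midpoint convexity. Each step
    divides by a sum of terms bounded through [Q = 1 + M ^+ 2], whence the factor [4 * Q ^+ 2]. *)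
Lemma phub_uniformly_convex M eta a b : 0 < eta ->
  `|a| <= M -> `|b| <= M -> eta <= `|a - b| ->
  2 * phub (2^-1 * (a + b)) + eta ^+ 2 / (4 * (1 + M ^+ 2) ^+ 2) <=
  phub a + phub b.
Proof.
move=> eta0 aM bM ab.
have a0 := phub_ge1 a; have b0 := phub_ge1 b; have c0 := phub_ge1 (2^-1 * (a + b)).
have := phub_sqr a; have := phub_sqr b; have := phub_sqr (2^-1 * (a + b)).
set C := phub _ in c0 *; set B := phub _ in b0 *; set A := phub _ in a0 *.
set Q := 1 + M ^+ 2 => EC EB EA.
have sqM z : `|z| <= M -> z ^+ 2 <= M ^+ 2.
  by move=> zM; rewrite -(real_normK (num_real z)) ler_sqr ?nnegrE// (le_trans _ zM).
have Q1 : 1 <= Q by rewrite /Q lerDl sqr_ge0.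
have A2 : A ^+ 2 <= Q by rewrite EA lerD2l sqM.
have B2 : B ^+ 2 <= Q by rewrite EB lerD2l sqM.
have AQ : A <= Q by nra.
have BQ : B <= Q by nra.
have abe : eta ^+ 2 <= (a - b) ^+ 2.
  by rewrite -(real_normK (num_real (a - b))) ler_sqr ?nnegrE// ltW.
have ABQ : A * B <= Q by nra.
have D1 : (A * B) ^+ 2 - (1 + a * b) ^+ 2 = (a - b) ^+ 2.
  by rewrite exprMn EA EB; ring.
have D2 : (A + B) ^+ 2 - (2 * C) ^+ 2 = 2 * (A * B - (1 + a * b)).
  by rewrite exprMn EC sqrrD EA EB; field.
have AB0 : 0 < A * B by nra.
have le1 : 1 + a * b <= A * B.
  rewrite leNgt; apply/negP => lt1.
  have : (A * B) ^+ 2 < (1 + a * b) ^+ 2 by rewrite ltr_sqr ?nnegrE// ?ltW// (lt_trans AB0).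
  nra.
have D3 : eta ^+ 2 <= 2 * Q * (A * B - (1 + a * b)).
  apply: le_trans abe _; rewrite -D1 subr_sqr mulrC; apply: ler_wpM2r; lra.
have CAB : 2 * C <= A + B.
  rewrite leNgt; apply/negP => lt1.
  have : (A + B) ^+ 2 < (2 * C) ^+ 2 by rewrite ltr_sqr ?nnegrE//; lra.
  nra.
have D4 : eta ^+ 2 <= Q * ((A + B - 2 * C) * (4 * Q)).
  have : Q * ((A + B - 2 * C) * (A + B + 2 * C)) <= Q * ((A + B - 2 * C) * (4 * Q)).
    by apply: ler_wpM2l; [lra|apply: ler_wpM2l; lra].
  by rewrite -subr_sqr D2; nra.
rewrite addrC -lerBrDr ler_pdivrMr; last by rewrite mulr_gt0// exprn_gt0//; lra.
by apply: le_trans D4 _; rewrite le_eqVlt; apply/orP; left; apply/eqP; ring.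
Qed.

Lemma continuous_phub : continuous phub.
Proof.
move=> t; apply: (@continuous_comp _ _ _ (fun t => 1 + t ^+ 2) Num.sqrt).
  by apply: cvgD; [exact: cvg_cst|exact: exprn_continuous].
exact: sqrt_continuous.
Qed.

Lemma continuous_dphub : continuous dphub.
Proof.
move=> t; apply: cvgM; first exact: cvg_id.
by apply: cvgV; [rewrite gt_eqF// phub_gt0|exact: continuous_phub].
Qed.

End pseudo_huber.

(** * Convergence in probability *)

Section probability_tools.
Context d (T : measurableType d) (R : realType) (mu : probability T R).
Local Notation L0 := (L0 mu).
Local Notation fnm := (@fn_measurable d T R mu).

Lemma measurable_phub (f : T -> R) : measurable_fun setT f ->
  measurable_fun setT (@phub R \o f).
Proof.
move=> mf; apply: measurableT_comp => //.
by apply: continuous_measurable_fun; exact: continuous_phub.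
Qed.

Lemma measurable_dphub (f : T -> R) : measurable_fun setT f ->
  measurable_fun setT (@dphub R \o f).
Proof.
move=> mf; apply: measurableT_comp => //.
by apply: continuous_measurable_fun; exact: continuous_dphub.
Qed.

Lemma measurable_norm_le (f : T -> R) M : measurable_fun setT f ->
  measurable [set x | `|f x| <= M].
Proof.
move=> mf.
rewrite (_ : mkset _ = setT `&` (fun x => `|f x|) @^-1` `]-oo, M]).
  by apply: (measurableT_comp (@normr_measurable _ setT) mf) => //.
by apply/seteqP; split => x /=; rewrite in_itv/=; tauto.
Qed.

Lemma measurable_norm_gt (f : T -> R) M : measurable_fun setT f ->
  measurable [set x | M < `|f x|].
Proof.
move=> mf; rewrite (_ : mkset _ = ~` [set x | `|f x| <= M]).
  exact/measurableC/measurable_norm_le.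
by apply/seteqP; split => x /=; rewrite ltNge => /negP.
Qed.

Lemma measurable_norm_ge (f : T -> R) M : measurable_fun setT f ->
  measurable [set x | M <= `|f x|].
Proof.
move=> mf.
rewrite (_ : mkset _ = setT `&` (fun x => `|f x|) @^-1` `[M, +oo[).
  by apply: (measurableT_comp (@normr_measurable _ setT) mf) => //.
by apply/seteqP; split => x /=; rewrite in_itv/= andbT; tauto.
Qed.

Lemma cvg_lte (u : nat -> \bar R) l (e : \bar R) : u @ \oo --> l -> (l < e)%E ->
  \forall n \near \oo, (u n < e)%E.
Proof.
by move=> cv le; exact: cv _ (open_ereal_lt' le).
Qed.

(** The sets where [|f|] exceeds [n] decrease to the empty set, and [mu] is finite, so continuity
    from above applies. *)
Lemma measurable_tight (f : T -> R) (eps : R) : measurable_fun setT f -> 0 < eps ->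
  exists2 M : R, 0 < M & (mu [set x | (M < `|f x|)%R] <= eps%:E)%E.
Proof.
move=> mf e0; pose E n := [set x | n%:R < `|f x|].
have mE n : measurable (E n) by exact: measurable_norm_gt.
have cap0 : \bigcap_n E n = set0.
  apply/seteqP; split => // x Ex.
  have /= := Ex (Num.truncn `|f x|).+1 I.
  by rewrite /E/= ltNge => /negP; apply; apply/ltW; exact: truncnS_gt.
have cv : mu \o E @ \oo --> 0%E.
  rewrite -(measure0 mu) -cap0; apply: nonincreasing_cvg_mu => //.
  - by rewrite (le_lt_trans (probability_le1 mu (mE 0%N)))// ltry.
  - by rewrite cap0.
  - apply/nonincreasing_seqP => n; apply/subsetPset => x; rewrite /E/=.
    by apply: le_lt_trans; rewrite ler_nat.
have [|N _ /(_ N.+1) H] := cvg_lte cv (_ : 0%E < eps%:E)%E; first by rewrite lte_fin.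
by exists N.+1%:R => //; apply/ltW/H => /=.
Qed.

Lemma bigcup_tail_le (E : nat -> set T) N : (forall n, measurable (E n)) ->
  (forall n, (mu (E n) <= (2^-1 ^+ n)%:E)%E) ->
  (mu (\bigcup_(n in [set n | (N <= n)%N]) E n) <= (2 * 2^-1 ^+ N)%:E)%E.
Proof.
move=> mE Ele.
have -> : \bigcup_(n in [set n | (N <= n)%N]) E n = \bigcup_n E (N + n)%N.
  apply/seteqP; split => x [n nN Ex].
    by exists (n - N)%N => //; rewrite subnKC.
  by exists (N + n)%N => //=; exact: leq_addr.
apply: le_trans (measure_sigma_subadditive mu _ _ (@subset_refl _ _)) _.
- by move=> n; exact: mE.
- by apply: bigcup_measurable => n _; exact: mE.
apply: lime_le; first exact: is_cvg_nneseries.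
apply: nearW => n; apply: (@le_trans _ _ (\sum_(0 <= i < n) (2^-1 ^+ (N + i))%:E)%E).
  by apply: lee_sum => i _; exact: Ele.
rewrite sumEFin lee_fin.
suff -> : \sum_(0 <= i < n) (2^-1 ^+ (N + i) : R) = 2 * 2^-1 ^+ N - 2 * 2^-1 ^+ (N + n).
  by rewrite gerBl mulr_ge0// exprn_ge0.
elim: n => [|n IH]; first by rewrite big_nil addn0 subrr.
by rewrite big_nat_recr//= IH addnS exprS; field.
Qed.

Lemma Borel_Cantelli_geometric (E : nat -> set T) : (forall n, measurable (E n)) ->
  (forall n, (mu (E n) <= (2^-1 ^+ n)%:E)%E) ->
  {ae mu, forall x, exists N, forall n, (N <= n)%N -> ~ E n x}.
Proof.
move=> mE Ele.
pose U N := \bigcup_(n in [set n | (N <= n)%N]) E n.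
have mU N : measurable (U N) by apply: bigcup_measurable => n _; exact: mE.
have mI : measurable (\bigcap_N U N) by exact: bigcap_measurableType.
exists (\bigcap_N U N); split => //.
  apply/eqP; rewrite eq_le measure_ge0 andbT; apply/lee_addgt0Pr => e e0.
  rewrite add0e.
  have half : `|2^-1 : R| < 1 by rewrite ger0_norm// invf_lt1// ltr1n.
  have /cvgrPdist_lt /(_ (e / 2)) : (fun n => (2^-1 : R) ^+ n) @ \oo --> 0.
    exact: cvg_expr.
  rewrite divr_gt0// => /(_ isT)[N _ /(_ N (leqnn N))] /=.
  rewrite sub0r normrN ger0_norm ?exprn_ge0// => HN.
  apply: le_trans (le_measure _ _ _ (_ : _ `<=` U N)) _; rewrite ?inE//.
    by move=> x; exact.
  apply: le_trans (bigcup_tail_le N mE Ele) _; rewrite lee_fin; lra.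
move=> x /= nx N _; apply: contrapT => nU; apply: nx; exists N => n Nn Ex.
by apply: nU; exists n.
Qed.

End probability_tools.

(** * Completeness for convergence in probability *)

Lemma cvg_of_dyadic_steps (R : realType) (a : nat -> R) N :
  (forall n, (N <= n)%N -> `|a n - a n.+1| < 2^-1 ^+ n) ->
  cvgn a /\ forall n, (N <= n)%N -> `|a n - limn a| <= 2 * 2^-1 ^+ n.
Proof.
move=> step.
have tail n k : (N <= n)%N ->
    `|a n - a (n + k)%N| <= 2 * 2^-1 ^+ n - 2 * 2^-1 ^+ (n + k).
  move=> Nn; elim: k => [|k IH]; first by rewrite addn0 !subrr normr0.
  have := step (n + k)%N (leq_trans Nn (leq_addr _ _)).
  have := ler_normD (a n - a (n + k)%N) (a (n + k)%N - a (n + k).+1).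
  rewrite addnS exprS addrA subrK; lra.
have tail' n m : (N <= n)%N -> (n <= m)%N -> `|a n - a m| <= 2 * 2^-1 ^+ n.
  move=> Nn nm; rewrite -(subnKC nm); apply: le_trans (tail n _ Nn) _.
  by rewrite gerBl mulr_ge0// exprn_ge0.
have cv : cvgn a.
  apply/cauchy_cvgP; apply: cauchy_exP => e e0.
  have half : `|2^-1 : R| < 1 by rewrite ger0_norm// invf_lt1// ltr1n.
  have /cvgrPdist_lt /(_ (e / 2)) := cvg_expr half.
  rewrite divr_gt0// => /(_ isT)[M _ HM].
  have := HM (maxn M N) (leq_maxl _ _).
  rewrite sub0r normrN ger0_norm ?exprn_ge0// => h.
  exists (a (maxn M N)); exists (maxn M N) => // m /= hm.
  by apply: le_lt_trans (tail' _ _ (leq_maxr _ _) hm) _; lra.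
split => // n Nn.
have cn : (fun m => `|a n - a m|) @ \oo --> `|a n - limn a|.
  by apply: cvg_norm; apply: cvgB; [exact: cvg_cst|exact: cv].
rewrite -(cvg_lim _ cn)//; apply: limr_le; first exact: cvgP cn.
by exists n => // m /= nm; exact: tail'.
Qed.

Section complete.
Context d (T : measurableType d) (R : realType) (mu : probability T R).
Local Notation L0 := (L0 mu).

Lemma le_measure_ae (A B : set T) : measurable A -> measurable B ->
  {ae mu, forall x, A x -> B x} -> (mu A <= mu B)%E.
Proof.
move=> mA mB [N [mN N0 sub]].
apply: (@le_trans _ _ (mu (B `|` N))).
  apply: le_measure; rewrite ?inE//; first exact: measurableU.
  move=> x Ax; have [Bx|nBx] := pselect (B x); [by left|right].
  by apply: sub => /= h; exact/nBx/h.
by apply: le_trans (measureU2 _ _ _) _ => //; rewrite [X in (_ + X)%E]N0 adde0.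
Qed.

(** By Borel-Cantelli almost every point eventually sees only dyadically small steps, which gives
    the pointwise limit. The explicit remainder [2 * 2^-1 ^+ n], valid off a union of measure at
    most [2 * 2^-1 ^+ n], gives the limit in probability. *)
Lemma fast_cauchy_in_prob (u : nat -> L0) :
  (forall n, (mu [set x | (2^-1 ^+ n <= `|fn (u n) x - fn (u n.+1) x|)%R]
     <= (2^-1 ^+ n)%:E)%E) ->
  exists h : L0, cvg_in_prob u h /\
    {ae mu, forall x, (fun n => fn (u n) x) @ \oo --> fn h x}.
Proof.
pose E n := [set x | 2^-1 ^+ n <= `|fn (u n) x - fn (u n.+1) x|].
move=> Ele; have {}Ele n : (mu (E n) <= (2^-1 ^+ n)%:E)%E := Ele n.
have mE n : measurable (E n).
  by apply: measurable_norm_ge; apply: measurable_funB; exact: fn_measurable.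
have BC := Borel_Cantelli_geometric mE Ele.
(* The upper limit is measurable on the whole space and agrees with the limit wherever the latter
   exists; [fine] only fills in values at the remaining points. *)
pose f x := fine (limn_esup (fun n => (fn (u n) x)%:E)).
have [|h hf] := @L0_ofP _ T R mu f.
  apply: measurableT_comp => //; apply: measurable_fun_limn_esup => n.
  by apply/measurable_EFinP; exact: fn_measurable.
have fE x : cvgn (fun n => fn (u n) x) -> f x = limn (fun n => fn (u n) x).
  move=> cv.
  have cvE : (fun n => (fn (u n) x)%:E) @ \oo --> (limn (fun n => fn (u n) x))%:E.
    by apply/fine_cvgP; split; [exact: nearW|exact: cv].
  by rewrite /f is_cvg_limn_esupE ?(cvg_lim _ cvE)//; exact: cvgP cvE.
have lim x N : (forall n, (N <= n)%N -> ~ E n x) -> fn h x = f x ->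
    (fun n => fn (u n) x) @ \oo --> fn h x /\
    forall n, (N <= n)%N -> `|fn (u n) x - fn h x| <= 2 * 2^-1 ^+ n.
  move=> nE hx; have [|cv le] := @cvg_of_dyadic_steps R (fun n => fn (u n) x) N.
    by move=> n /nE /negP; rewrite -ltNge.
  by rewrite hx fE.
exists h; split; last first.
  by apply: filterS2 BC hf => x [N nE] hx; case: (lim _ _ nE hx).
move=> eps e0.
have half : `|2^-1 : R| < 1 by rewrite ger0_norm// invf_lt1// ltr1n.
have cv0 : (fun n => 2 * 2^-1 ^+ n : R) @ \oo --> 0.
  by rewrite -[X in _ --> X](mulr0 2); apply: cvgM; [exact: cvg_cst|exact: cvg_expr].
apply: (@squeeze_cvge _ _ _ _ (cst 0%E) _ (fun n => (2 * 2^-1 ^+ n)%:E)).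
- have /cvgrPdist_lt /(_ eps e0) := cv0; apply: filterS => n.
  rewrite sub0r normrN ger0_norm; last by rewrite mulr_ge0// exprn_ge0.
  move=> ne; rewrite measure_ge0/=.
  apply: le_trans (bigcup_tail_le n mE Ele); apply: le_measure_ae.
  + by apply: measurable_norm_ge; apply: measurable_funB; exact: fn_measurable.
  + by apply: bigcup_measurable => k _; exact: mE.
  apply: filterS hf => x hx /= le; apply: contrapT => nU.
  have nE k : (n <= k)%N -> ~ E k x by move=> nk Ekx; apply: nU; exists k.
  have [_ /(_ n (leqnn n))] := lim _ _ nE hx; lra.
- exact: cvg_cst.
- by apply/fine_cvgP; split; [exact: nearW|exact: cv0].
Qed.

End complete.

(** * Minimization over sets closed in probability *)

Lemma le_limn_einf (R : realType) (u v : nat -> \bar R) :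
  (forall n, (u n <= v n)%E) -> (limn_einf u <= limn_einf v)%E.
Proof.
move=> uv; rewrite !limn_einf_lim.
apply: lee_lim; [exact: is_cvg_einfs|exact: is_cvg_einfs|].
apply: nearW => n; apply: le_ereal_inf_tmp => _ [k /= nk <-].
by apply: le_trans (uv k); apply: ereal_inf_lbound; exists k.
Qed.

Lemma limn_einf_ge (R : realType) (u : nat -> \bar R) c :
  (forall n, (c <= u n)%E) -> (c <= limn_einf u)%E.
Proof.
move=> cu; have [<- _] := cvg_limn_einf_sup (cvg_cst c : cst c @ \oo --> c).
exact: le_limn_einf.
Qed.

Section minimizer.
Context d (T : measurableType d) (R : realType) (mu : probability T R).
Local Notation L0 := (L0 mu).
Variables (W : T -> R) (x0 : L0).
Hypotheses (mW : measurable_fun setT W) (W0 : forall x, 0 < W x).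

Definition phub_integrand (h : L0) x := phub (fn h x - fn x0 x) * W x.
Definition phub_cost h := (\int[mu]_x (phub_integrand h x)%:E)%E.

Lemma phub_integrand_ge0 h x : 0 <= phub_integrand h x.
Proof. by rewrite mulr_ge0 ?phub_ge0// ltW. Qed.

Lemma measurable_phub_integrand h : measurable_fun setT (phub_integrand h).
Proof.
apply: measurable_funM => //; apply: (measurable_phub (f := fun x => fn h x - fn x0 x)).
by apply: measurable_funB; exact: fn_measurable.
Qed.
Local Hint Resolve phub_integrand_ge0 measurable_phub_integrand : core.

Lemma phub_cost_ge0 h : (0 <= phub_cost h)%E.
Proof. by apply: integral_ge0 => x _; rewrite lee_fin. Qed.

(** The midpoint inequality for [phub], with an extra gain [kappa] on [E], is integrated. Keeping
    every term positive, with no subtraction, allows infinite costs. *)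
Lemma phub_cost_midpoint (h h' : L0) (kappa : R) (E : set T) :
  0 <= kappa -> measurable E ->
  (forall x, E x -> 2 * phub (2^-1 * ((fn h x - fn x0 x) + (fn h' x - fn x0 x))) * W x
      + kappa <= phub_integrand h x + phub_integrand h' x) ->
  (2%:E * phub_cost (2^-1 *: h + (1 - 2^-1) *: h')%R + kappa%:E * mu E
    <= phub_cost h + phub_cost h')%E.
Proof.
move=> k0 mE HE; set m := 2^-1 *: h + _ *: h'.
have mJ k : measurable_fun setT (EFin \o phub_integrand k) by exact/measurable_EFinP.
have J0 k x : (0 <= (phub_integrand k x)%:E)%E by rewrite lee_fin.
have mI : measurable_fun setT (EFin \o (\1_E : T -> R)) by exact/measurable_EFinP.
have I0 x : (0 <= (\1_E x : R)%:E)%E by rewrite lee_fin indicE.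
have EI : mu E = (\int[mu]_x (\1_E x)%:E)%E.
  by rewrite integral_indic// setIT.
rewrite EI /phub_cost.
rewrite -[X in (X + _)%E]ge0_integralZl//=; last exact: mJ.
rewrite -[X in (_ + X <= _)%E]ge0_integralZl//=.
rewrite -[X in (X <= _)%E]ge0_integralD//=; last 4 first.
- by move=> x _; apply: mule_ge0.
- by apply: emeasurable_funM => //; exact: mJ.
- by move=> x _; apply: mule_ge0; rewrite ?lee_fin.
- by apply: emeasurable_funM => //.
rewrite -[X in (_ <= X)%E]ge0_integralD//=; try exact: mJ.
apply: ae_ge0_le_integral => //=.
- by move=> x _; apply: adde_ge0; apply: mule_ge0; rewrite ?lee_fin.
- by apply: emeasurable_funD; apply: emeasurable_funM => //; exact: mJ.
- by move=> x _; apply: adde_ge0.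
- by apply: emeasurable_funD; exact: mJ.
have := fnD (2^-1 *: h) ((1 - 2^-1) *: h'); have := fnZ 2^-1 h; have := fnZ (1 - 2^-1) h'.
apply: filterS3 => x e1 e2 e3 _.
rewrite -!EFinM -!EFinD lee_fin.
have -> : phub_integrand m x =
    phub (2^-1 * ((fn h x - fn x0 x) + (fn h' x - fn x0 x))) * W x.
  by rewrite /phub_integrand /m e3 e1 e2; congr (phub _ * _); field.
rewrite mulrA indicE.
have [Ex|nEx] := pselect (E x); first by rewrite mem_set// mulr1; exact: HE.
rewrite memNset// mulr0 addr0 -mulrDl ler_pM2r//.
set a := _ - _; set b := _ - _.
(* Outside [E] plain midpoint convexity is enough: the linear terms of the two subgradient
   inequalities at the midpoint cancel. *)
have A1 := phub_subgradient (2^-1 * (a + b)) a.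
have B1 := phub_subgradient (2^-1 * (a + b)) b.
by move: A1 B1; set D := dphub _; set P := phub (2^-1 * _); lra.
Qed.

(** The midpoint of two near-minimizers lies in [A], so its cost is at least [m]. Hence the gain
    from uniform convexity, and with it the set where the two functions differ by [eta], must be
    small. The bound [delta] is uniform over [A] because [B] is bounded in probability. *)
Lemma phub_cost_modulus (A B : set L0) (m eta : R) :
  bounded_in_prob B -> A `<=` B -> B x0 ->
  Defs.convex_set A -> (forall h, A h -> (m%:E <= phub_cost h)%E) -> 0 < eta ->
  exists2 delta : R, 0 < delta & forall h h', A h -> A h' ->
    (phub_cost h <= (m + delta)%:E)%E -> (phub_cost h' <= (m + delta)%:E)%E ->
    (mu [set x | (eta <= `|fn h x - fn h' x|)%R] <= eta%:E)%E.
Proof.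
move=> bB AB Bx0 cA Am e0.
have e8 : 0 < eta / 8 by rewrite divr_gt0.
have [M0 HM0] := bB _ e8; pose M : R := `|M0|.
have HM h : B h -> (mu [set x | (M < `|fn h x|)%R] <= (eta / 8)%:E)%E.
  move=> /HM0; apply: le_trans; apply: le_measure; rewrite ?inE;
    try by apply: measurable_norm_gt; exact: fn_measurable.
  by move=> x /=; apply: le_lt_trans; exact: ler_norm.
have mV : measurable_fun setT (fun x => ln (W x)).
  by apply: (measurableT_comp _ mW); exact: measurable_ln.
(* Tightness of [ln W] gives [W >= expR (- N)] off a set of measure [eta / 8]. *)
have [N N0 HN] := measurable_tight mu mV e8.
pose c := eta ^+ 2 / (4 * (1 + (2 * M) ^+ 2) ^+ 2).
have c0 : 0 < c.
  rewrite divr_gt0 ?exprn_gt0// mulr_gt0// exprn_gt0//.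
  by rewrite ltr_wpDr// sqr_ge0.
pose kappa := c * expR (- N).
have k0 : 0 < kappa by rewrite mulr_gt0// expR_gt0.
(* With this choice [2 * m + kappa * mu E <= 2 * m + 2 * delta] yields [mu E <= eta / 2]. The other
   half of [eta] pays for the four exceptional sets in [D], each of measure at most [eta / 8]. *)
exists (kappa * eta / 4); first by rewrite divr_gt0// mulr_gt0.
move=> h h' Ah Ah' Jh Jh'.
pose S := [set x | (eta <= `|fn h x - fn h' x|)%R].
pose G (k : L0) := [set x | (M < `|fn k x|)%R].
pose V := [set x | N < `|ln (W x)|].
have mS : measurable S.
  by apply: measurable_norm_ge; apply: measurable_funB; exact: fn_measurable.
have mG k : measurable (G k) by apply: measurable_norm_gt; exact: fn_measurable.
have mmV : measurable V by exact: measurable_norm_gt.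
pose D := (G h `|` G h') `|` (G x0 `|` V).
have mD : measurable D by do ![apply: measurableU => //].
have muD : (mu D <= (eta / 2)%:E)%E.
  have HMh := HM _ (AB _ Ah); have HMh' := HM _ (AB _ Ah'); have HMx := HM _ Bx0.
  apply: le_trans (measureU2 _ _ _) _; [exact: measurableU..|].
  rewrite (_ : eta / 2 = (eta / 8 + eta / 8) + (eta / 8 + eta / 8)); last by field.
  rewrite !EFinD; apply: leeD; (apply: le_trans (measureU2 _ _ _) _ => //; exact: leeD).
pose E := S `\` D.
have mE : measurable E by exact: measurableD.
have ltk : (0 <= kappa) by exact: ltW.
have HE x : E x -> 2 * phub (2^-1 * ((fn h x - fn x0 x) + (fn h' x - fn x0 x))) * W x
      + kappa <= phub_integrand h x + phub_integrand h' x.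
  move=> [Sx /not_orP[/not_orP[nh nh'] /not_orP[nx nV]]].
  move: Sx nh nh' nx nV; rewrite /S/G/V/= => Sx /negP + /negP + /negP + /negP.
  rewrite -!leNgt => hM h'M xM WN.
  have aM : `|fn h x - fn x0 x| <= 2 * M by apply: le_trans (ler_normB _ _) _; lra.
  have bM : `|fn h' x - fn x0 x| <= 2 * M by apply: le_trans (ler_normB _ _) _; lra.
  have Sx' : eta <= `|(fn h x - fn x0 x) - (fn h' x - fn x0 x)|.
    by rewrite opprB addrA subrK.
  have := phub_uniformly_convex e0 aM bM Sx'; rewrite -/c /phub_integrand.
  have WN' : expR (- N) <= W x.
    rewrite -[leRHS]lnK ?posrE// ler_expR.
    by move: WN; rewrite ler_norml => /andP[].
  have : kappa <= c * W x by rewrite /kappa ler_pM2l.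
  set P := phub (2^-1 * _); set P1 := phub _; set P2 := phub _.
  move=> h1 h2; apply: (@le_trans _ _ ((2 * P + c) * W x)); first by lra.
  by rewrite -mulrDl ler_pM2r.
have := phub_cost_midpoint ltk mE HE.
have half01 : 0 <= (2^-1 : R) <= 1 by rewrite invr_ge0 ler0n/= invf_le1 ?ler1n.
have /Am := cA _ _ _ Ah Ah' half01.
rewrite L0addE !L0scaleE.
set mid := 2^-1 *: h + _; move=> Jm H.
have fE : mu E \is a fin_num by exact: fin_num_measure.
have {}H : ((2 * m)%:E + kappa%:E * mu E <= (2 * m + 2 * (kappa * eta / 4))%:E)%E.
  apply: le_trans (le_trans H _).
    apply: leeD => //; rewrite EFinM; apply: lee_wpmul2l => //.
  apply: le_trans (leeD Jh Jh') _; rewrite -EFinD lee_fin; lra.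
have muE : (mu E <= (eta / 2)%:E)%E.
  move: H; rewrite -(fineK fE) -EFinM -EFinD !lee_fin => H.
  rewrite -(ler_pM2l k0); lra.
apply: (@le_trans _ _ (mu (E `|` D))).
  apply: le_measure; rewrite ?inE//; first exact: measurableU.
  by move=> x Sx; have [?|?] := pselect (D x); [right|left].
apply: le_trans (measureU2 _ _ _) _ => //.
by rewrite [eta]splitr EFinD; apply: leeD.
Qed.

(** Fatou's lemma for the nonnegative integrands, which converge almost everywhere. *)
Lemma phub_cost_lsc (u : nat -> L0) (h : L0) (m : \bar R) (e : nat -> R) :
  {ae mu, forall x, (fun n => fn (u n) x) @ \oo --> fn h x} ->
  (forall n, (phub_cost (u n) <= m + (e n)%:E)%E) ->
  e @ \oo --> 0 -> (phub_cost h <= m)%E.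
Proof.
move=> uh Ju e0.
have mJ k : measurable_fun setT (EFin \o phub_integrand k) by exact/measurable_EFinP.
have J0 k x : (0 <= (phub_integrand k x)%:E)%E by rewrite lee_fin.
have cvJ x : (fun n => fn (u n) x) @ \oo --> fn h x ->
    (fun n => (phub_integrand (u n) x)%:E) @ \oo --> (phub_integrand h x)%:E.
  move=> cx; apply/fine_cvgP; split; first exact: nearW.
  apply: cvgM; last exact: cvg_cst.
  apply: continuous_cvg.
    exact: continuous_phub.
  by apply: cvgB => //; exact: cvg_cst.
have Je0 x : (0 <= limn_einf (fun n => (phub_integrand (u n) x)%:E))%E.
  by apply: limn_einf_ge => n; exact: J0.
apply: (@le_trans _ _ (\int[mu]_x limn_einf (fun n => (phub_integrand (u n) x)%:E))%E).
  apply: ae_ge0_le_integral => //; first exact: mJ.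
    rewrite /limn_einf; apply: measurableT_comp => //.
    apply: measurable_fun_limn_esup => n.
    by apply: measurableT_comp => //; exact: mJ.
  by apply: filterS uh => x /cvJ /cvg_limn_einf_sup[-> _].
have fat := fatou mu measurableT (fun n => mJ (u n)) (fun n x _ => J0 (u n) x).
apply: le_trans fat _.
have me : (fun n => (m + (e n)%:E)%E) @ \oo --> (m + 0)%E.
  apply: cvgeD => //; first exact: fin_num_adde_defl.
    exact: cvg_cst.
  by apply/fine_cvgP; split; [exact: nearW|exact: e0].
rewrite -[leRHS]adde0 -(cvg_limn_einf_sup me).1.
by apply: le_limn_einf => n; exact: Ju.
Qed.

(** A minimizing sequence chosen fast enough is Cauchy in probability by [phub_cost_modulus]. Its
    limit stays in [A] by closedness and is optimal by [phub_cost_lsc]. *)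
Lemma exists_minimizer (A B : set L0) : bounded_in_prob B -> A `<=` B -> B x0 ->
  Defs.convex_set A -> closed_in_prob A -> (exists h, A h /\ (phub_cost h < +oo)%E) ->
  exists2 h, A h & forall h', A h' -> (phub_cost h <= phub_cost h')%E.
Proof.
move=> bB AB Bx0 cA clA [h1 [Ah1 Jh1]].
pose mm := ereal_inf (phub_cost @` A).
have mm0 : (0 <= mm)%E by apply: le_ereal_inf_tmp => _ [h _ <-]; exact: phub_cost_ge0.
have mmoo : (mm <= phub_cost h1)%E by apply: ereal_inf_lbound; exists h1.
have mmfin : mm \is a fin_num.
  by rewrite ge0_fin_numE// (le_lt_trans mmoo).
pose m := fine mm; have mE : mm = m%:E by rewrite fineK.
have Am h : A h -> (m%:E <= phub_cost h)%E.
  by move=> Ah; rewrite -mE; apply: ereal_inf_lbound; exists h.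
have half n : 0 < (2^-1 : R) ^+ n by rewrite exprn_gt0.
have /choice[del delP] : forall n, exists delta : R, 0 < delta /\
    forall h h', A h -> A h' ->
    (phub_cost h <= (m + delta)%:E)%E -> (phub_cost h' <= (m + delta)%:E)%E ->
    (mu [set x | (2^-1 ^+ n <= `|fn h x - fn h' x|)%R] <= (2^-1 ^+ n)%:E)%E.
  by move=> n; have [dl ? ?] := phub_cost_modulus bB AB Bx0 cA Am (half n); exists dl.
(* At level [n] both [u n] and [u n.+1] must be within [del n] of the infimum, hence the bounds by
   [del n] and by [del n.-1]. The term [2^-1 ^+ n] makes the excess tend to 0. *)
pose e n := Num.min (2^-1 ^+ n) (Num.min (del n) (del n.-1)).
have e0 n : 0 < e n.
  by rewrite /e !lt_min half; have [-> _] := delP n; have [-> _] := delP n.-1.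
have /choice[u uP] : forall n, exists h, A h /\ (phub_cost h <= m%:E + (e n)%:E)%E.
  move=> n; have [_ [h Ah <-] lt] := lb_ereal_inf_adherent (e0 n) mmfin.
  by exists h; split => //; apply/ltW; rewrite -mE.
have uA n : A (u n) by case: (uP n).
have [|h [uh aeh]] := @fast_cauchy_in_prob _ _ _ _ u.
  move=> n; have [_ H] := delP n; apply: H => //.
    apply: le_trans (uP n).2 _; rewrite -EFinD lee_fin lerD2l /e.
    by rewrite !ge_min lexx /= orbT.
  apply: le_trans (uP n.+1).2 _; rewrite -EFinD lee_fin lerD2l /e.
  by rewrite !ge_min lexx /= !orbT.
exists h; first exact: clA uh.
move=> h' Ah'; apply: le_trans (Am _ Ah').
apply: phub_cost_lsc aeh (fun n => (uP n).2) _.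
have half1 : `|2^-1 : R| < 1 by rewrite ger0_norm// invf_lt1// ltr1n.
apply: (@squeeze_cvgr _ _ _ _ (cst 0) (fun n => 2^-1 ^+ n)).
- by apply: nearW => n; rewrite ltW//= /e ge_min lexx.
- exact: cvg_cst.
- exact: cvg_expr.
Qed.

End minimizer.

(** * The pairing of [EK K] and [EK' K] *)

Section pairing.
Context d (T : measurableType d) (R : realType) (mu : probability T R).
Local Notation L0 := (L0 mu).
Implicit Types (f g h : L0) (K A F : set L0).

Definition abs_pair f g := (\int[mu]_x (`|fn f x * fn g x|)%:E)%E.

Lemma measurable_fnM f g : measurable_fun setT (fun x => fn f x * fn g x).
Proof. by apply: measurable_funM; exact: fn_measurable. Qed.

Lemma measurable_abs_fnM f g :
  measurable_fun setT (fun x => (`|fn f x * fn g x|)%:E).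
Proof.
by apply/measurable_EFinP; apply: measurableT_comp => //; exact: measurable_fnM.
Qed.
Local Hint Resolve measurable_abs_fnM : core.

Lemma abs_pairC f g : abs_pair f g = abs_pair g f.
Proof. by apply: eq_integral => x _; rewrite mulrC. Qed.

Lemma abs_pair_le f g g' : {ae mu, forall x, `|fn g x| <= `|fn g' x|} ->
  (abs_pair f g <= abs_pair f g')%E.
Proof.
move=> gg'; apply: ae_ge0_le_integral => //.
apply: filterS gg' => x le _; rewrite lee_fin !normrM; exact: ler_wpM2l.
Qed.

Lemma abs_pairZ a f g : abs_pair f (a *: g) = (`|a|%:E * abs_pair f g)%E.
Proof.
rewrite /abs_pair -ge0_integralZl//=.
apply: ge0_ae_eq_integral => //.
  by apply: emeasurable_funM => //.
apply: filterS (fnZ a g) => x E _ /=; rewrite -EFinM; congr EFin.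
by rewrite E !normrM mulrCA.
Qed.

Lemma abs_pairD f g g' : (abs_pair f (g + g')%R <= abs_pair f g + abs_pair f g')%E.
Proof.
rewrite /abs_pair -ge0_integralD//=.
apply: ae_ge0_le_integral => //.
- by move=> x _; apply: adde_ge0; rewrite lee_fin.
- exact: emeasurable_funD.
apply: filterS (fnD g g') => x E _ /=; rewrite -EFinD lee_fin.
by rewrite E mulrDr; exact: ler_normD.
Qed.

Lemma abs_pair0 f : abs_pair f 0 = 0%E.
Proof. by rewrite -(scale0r f) abs_pairZ normr0 mul0e. Qed.

Lemma integrable_pair f g : (abs_pair f g < +oo)%E ->
  mu.-integrable setT (EFin \o (fun x => fn f x * fn g x)).
Proof.
move=> fin; apply/integrableP; split; last exact: fin.
by apply/measurable_EFinP; exact: measurable_fnM.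
Qed.

(** The finiteness hypothesis rules out the default value that [fine] gives to an infinite integral,
    so [pair] can be computed in the extended reals. *)
Lemma pairE f g k : (abs_pair f g < +oo)%E -> measurable_fun setT k ->
  {ae mu, forall x, fn f x * fn g x = k x} ->
  (pair f g)%:E = (\int[mu]_x (k x)%:E)%E.
Proof.
move=> fin mk fk; rewrite /pair /Rintegral fineK; last first.
  exact: integrable_fin_num (integrable_pair fin).
apply: ae_eq_integral => //; first exact: (measurable_int _ (integrable_pair fin)).
  exact/measurable_EFinP.
by apply: filterS fk => x /= -> _.
Qed.

Lemma pairDZ a f f' g : (abs_pair f g < +oo)%E -> (abs_pair f' g < +oo)%E ->
  pair (a *: f + f') g = a * pair f g + pair f' g.
Proof.
move=> If If'.
have If2 : (abs_pair (a *: f + f')%R g < +oo)%E.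
  rewrite abs_pairC; apply: le_lt_trans (abs_pairD _ _ _) _.
  by rewrite abs_pairZ !(abs_pairC g) lte_add_pinfty// lte_mul_pinfty.
have iZ : mu.-integrable setT (EFin \o (fun x => a * (fn f x * fn g x))).
  by apply: eq_integrable (integrableZl measurableT a (integrable_pair If)).
apply: EFin_inj; rewrite (pairE If2 (k := fun x => a * (fn f x * fn g x) + fn f' x * fn g x)).
- rewrite integralD_EFin//; last exact: integrable_pair.
  rewrite EFinD EFinM; congr (_ + _)%E.
    rewrite (pairE If (measurable_fnM f g)); last exact: nearW.
    rewrite -integralZl//; exact: integrable_pair.
  by rewrite (pairE If' (measurable_fnM f' g))//; exact: nearW.
- by apply: measurable_funD; [apply: measurable_funM => //|]; exact: measurable_fnM.
- have := fnD (a *: f) f'; have := fnZ a f.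
  by apply: filterS2 => x -> ->; ring.
Qed.

Lemma span_subspace A : linear_subspace (Defs.span A).
Proof.
split; first by exists (@nil (R * L0)).
move=> a _ _ [s [sA ->]] [t [tA ->]].
exists ([seq (a * p.1, p.2) | p <- s] ++ t); split.
  move=> p; rewrite mem_cat => /orP[/mapP[q qs ->]|]; [exact: (sA q)|exact: tA].
elim: s {sA} => [|p s IH] /=; first by rewrite L0zeroE scaler0 add0r.
by rewrite -IH !L0addE !L0scaleE scalerDr scalerA addrA.
Qed.

Lemma subset_span A : A `<=` Defs.span A.
Proof.
move=> f Af; exists [:: (1, f)]; split; first by move=> p; rewrite inE => /eqP ->.
by rewrite /= L0addE L0scaleE L0zeroE scale1r addr0.
Qed.

Lemma abs_pair_span_lty A g f : (forall a, A a -> (abs_pair g a < +oo)%E) ->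
  Defs.span A f -> (abs_pair g f < +oo)%E.
Proof.
move=> Ag [s [sA ->]]; elim: s sA => [|p s IH] sA /=.
  by rewrite L0zeroE abs_pair0.
rewrite L0addE L0scaleE; apply: le_lt_trans (abs_pairD _ _ _) _.
rewrite lte_add_pinfty//; last by apply: IH => q qs; apply: sA; rewrite inE qs orbT.
rewrite abs_pairZ lte_mul_pinfty//; apply: Ag; apply: sA; exact: mem_head.
Qed.

(** Multiples of the polar already exhaust its span, by the triangle inequality for [abs_pair]. This
    replaces linear combinations by a single uniform bound over [K]. *)
Lemma EK'P K g :
  EK' K g <-> exists2 c : R, 0 < c & forall f, K f -> (abs_pair f g <= c%:E)%E.
Proof.
split=> [[s [sA ->]]|[c c0 Kc]].
  elim: s sA => [|p s IH] sA /=.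
    by exists 1 => // f _; rewrite L0zeroE abs_pair0.
  have [|c c0 Kc] := IH; first by move=> q qs; apply: sA; rewrite inE qs orbT.
  exists (`|p.1| + c); first by rewrite ltr_wpDl.
  move=> f Kf; rewrite L0addE L0scaleE.
  apply: le_trans (abs_pairD _ _ _) _; rewrite EFinD; apply: leeD; last exact: Kc.
  rewrite abs_pairZ -[leRHS]mule1; apply: lee_wpmul2l => //.
  by apply: sA Kf; exact: mem_head.
exists [:: (c, c^-1 *: g)]; split.
  move=> _ /[!inE] /eqP -> f Kf /=; rewrite -/(abs_pair _ _) abs_pairZ.
  rewrite gtr0_norm ?invr_gt0//.
  apply: (@le_trans _ _ (c^-1%:E * c%:E)%E); last by rewrite -EFinM mulVf// gt_eqF.
  by apply: lee_wpmul2l; [rewrite lee_fin invr_ge0 ltW|exact: Kc].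
by rewrite /= L0addE L0scaleE L0zeroE addr0 scalerA divff ?gt_eqF// scale1r.
Qed.

Lemma abs_pair_lty K f g : EK K f -> EK' K g -> (abs_pair f g < +oo)%E.
Proof.
move=> Kf /EK'P[c c0 Kc]; rewrite abs_pairC; apply: abs_pair_span_lty Kf => a Ka.
by rewrite abs_pairC (le_lt_trans (Kc _ Ka))// ltry.
Qed.

(** [solid_in] only accepts candidates already in [EK' K]; the bound on [K] satisfied by [w] passes
    to anything dominated by [w]. *)
Lemma solid_exists K F w (k : T -> R) : F `<=` EK' K -> solid_in (EK' K) F -> F w ->
  measurable_fun setT k -> {ae mu, forall x, `|k x| <= `|fn w x|} ->
  exists2 g, F g & {ae mu, forall x, fn g x = k x}.
Proof.
move=> FK sF Fw mk kw; have [g gk] := L0_ofP mu mk; exists g => //.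
have gw : {ae mu, forall x, `|fn g x| <= `|fn w x|}.
  by apply: filterS2 gk kw => x ->.
apply: (sF w) => //; apply/EK'P.
have /EK'P[c c0 Kc] := FK _ Fw; exists c => // f Kf.
by apply: le_trans (Kc _ Kf); exact: abs_pair_le.
Qed.

Lemma scale_setP l K f : 0 < l -> scale_set l K f <-> K (l^-1 *: f).
Proof.
move=> l0; split=> [[h Kh <-]|Kf].
  by rewrite L0scaleE scalerA mulVf ?gt_eqF// scale1r.
by exists (l^-1 *: f) => //; rewrite L0scaleE scalerA divff ?gt_eqF// scale1r.
Qed.

Lemma absolutely_convex_scale K a f : absolutely_convex K -> K f -> `|a| <= 1 ->
  K (a *: f).
Proof.
move=> cK Kf a1; have := cK f f a 0 Kf Kf.
by rewrite L0addE !L0scaleE scale0r addr0 normr0 addr0; exact.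
Qed.

Lemma scale_set_le l m K : absolutely_convex K -> 0 < l -> l <= m ->
  scale_set l K `<=` scale_set m K.
Proof.
move=> cK l0 lm f; have m0 := lt_le_trans l0 lm.
move=> /(scale_setP _ _ l0) Kf; apply/(scale_setP _ _ m0).
have -> : m^-1 *: f = (l / m) *: (l^-1 *: f).
  by rewrite scalerA mulrAC divff ?gt_eqF// mul1r.
apply: absolutely_convex_scale => //.
by rewrite gtr0_norm ?divr_gt0// ler_pdivrMr// mul1r.
Qed.

Lemma scale_set_EK l K : scale_set l K `<=` EK K.
Proof.
move=> _ [f Kf <-]; rewrite L0scaleE -[_ *: f]addr0.
by apply: (span_subspace K).2; [exact: subset_span|exact: (span_subspace K).1].
Qed.

(** The gauge of [K] is finite on the span: along a linear combination the radii [|p.1|] add up. The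
    point [f0] ensures that [K] contains 0, which handles the empty combination. *)
Lemma EK_scale_set K f f0 : absolutely_convex K -> K f0 -> EK K f ->
  exists2 l, 0 < l & scale_set l K f.
Proof.
move=> cK Kf0 [s [sA ->]]; elim: s sA => [|p s IH] sA /=.
  exists 1 => //; apply/scale_setP => //; rewrite L0zeroE scaler0.
  by rewrite -(scale0r f0); apply: absolutely_convex_scale => //; rewrite normr0.
have [|l l0] := IH; first by move=> q qs; apply: sA; rewrite inE qs orbT.
move=> /(scale_setP _ _ l0); set h := foldr _ _ _ => Kh.
pose L := `|p.1| + l; have L0 : 0 < L by rewrite ltr_wpDl.
exists L => //; apply/scale_setP => //; rewrite L0addE L0scaleE scalerDr scalerA.
have -> : L^-1 *: h = (l / L) *: (l^-1 *: h).
  by rewrite scalerA mulrAC divff ?gt_eqF// mul1r.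
apply: cK => //; first by apply: sA; exact: mem_head.
rewrite normrM [`|l / L|]gtr0_norm ?divr_gt0// gtr0_norm ?invr_gt0//.
by rewrite mulrC -mulrDl divff// gt_eqF.
Qed.

Lemma bounded_in_prob_scale K l : 0 < l -> bounded_in_prob K ->
  bounded_in_prob (scale_set l K).
Proof.
move=> l0 bK e e0; have [M HM] := bK _ e0; exists (l * M) => _ [f Kf <-].
apply: le_trans (HM _ Kf); apply: le_measure_ae.
- by apply: measurable_norm_gt; exact: fn_measurable.
- by apply: measurable_norm_gt; exact: fn_measurable.
by apply: filterS (fnZ l f) => x /= ->; rewrite normrM gtr0_norm// ltr_pM2l.
Qed.

Lemma cvg_in_prob_scale (u : nat -> L0) f a : a != 0 -> cvg_in_prob u f ->
  cvg_in_prob (fun n => a *: u n) (a *: f).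
Proof.
move=> a0 uf e e0; have a0' : 0 < `|a| by rewrite normr_gt0.
have := uf (e / `|a|) (divr_gt0 e0 a0').
apply: squeeze_cvge (cvg_cst _) => //; apply: nearW => n.
rewrite measure_ge0/=; apply: le_measure_ae.
- by apply: measurable_norm_ge; apply: measurable_funB; exact: fn_measurable.
- by apply: measurable_norm_ge; apply: measurable_funB; exact: fn_measurable.
have := fnZ a (u n); have := fnZ a f; apply: filterS2 => x /= -> ->.
by rewrite -mulrBr normrM ler_pdivrMr// mulrC.
Qed.

Lemma closed_in_prob_scale K l : 0 < l -> closed_in_prob K ->
  closed_in_prob (scale_set l K).
Proof.
move=> l0 clK u f uK uf; apply/scale_setP => //.
apply: (clK (fun n => l^-1 *: u n)); last first.
  by apply: cvg_in_prob_scale; rewrite // invr_eq0 gt_eqF.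
by move=> n; apply/(scale_setP _ _ l0).
Qed.

(* The weight can be taken bounded and everywhere positive without leaving the
   solid hull of [w]. *)
Lemma positive_weight (w : L0) : {ae mu, forall x, 0 < fn w x} ->
  exists W : T -> R, [/\ measurable_fun setT W, forall x, 0 < W x,
    forall x, W x <= 1 & {ae mu, forall x, `|W x| <= `|fn w x|}].
Proof.
move=> w0; pose W x := if 0 < fn w x then Num.min (fn w x) 1 else 1.
exists W; split.
- apply: measurable_fun_ifT => //; last first.
    by apply: measurable_minr => //; exact: fn_measurable.
  by apply: measurable_fun_ltr => //; exact: fn_measurable.
- by move=> x; rewrite /W; case: ifPn => // h; rewrite lt_min h ltr01.
- by move=> x; rewrite /W; case: ifPn => // h; rewrite ge_min lexx orbT.
- apply: filterS w0 => x w0; rewrite /W w0 !ger0_norm ?ge_min ?lexx//.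
  + exact: ltW.
  + by rewrite le_min ltW//= ler01.
Qed.

(** The integrand of [pair (h - f) g] is [dphub t * t] times a nonnegative weight, with [t = h - f].
    It is nonnegative, and on [B] it vanishes only where [t = 0]. *)
Lemma pair_dphub_le0 h f g (W : T -> R) (B : set T) : measurable B ->
  measurable_fun setT W -> (forall x, 0 < W x) ->
  (abs_pair (h - f)%R g < +oo)%E ->
  {ae mu, forall x, fn g x = \1_B x * dphub (fn h x - fn f x) * W x} ->
  pair (h - f) g <= 0 -> {ae mu, forall x, B x -> fn h x = fn f x}.
Proof.
move=> mB mW W0 fin gE le0.
pose k x := \1_B x * (dphub (fn h x - fn f x) * (fn h x - fn f x)) * W x.
have k0 x : 0 <= k x.
  by apply: mulr_ge0; [apply: mulr_ge0; [by rewrite indicE ler0n|exact: dphubM_ge0]|exact: ltW].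
have mhf : measurable_fun setT (fun x => fn h x - fn f x).
  by apply: measurable_funB; exact: fn_measurable.
have mk : measurable_fun setT k.
  apply: measurable_funM => //; apply: measurable_funM => //.
  by apply: measurable_funM => //; exact: measurable_dphub mhf.
have E : (pair (h - f) g)%:E = (\int[mu]_x (k x)%:E)%E.
  apply: pairE => //; apply: filterS2 gE (fnB h f) => x -> ->; rewrite /k; ring.
have : (\int[mu]_x `|(k x)%:E|)%E = 0%E.
  apply/eqP; rewrite eq_le integral_ge0 ?andbT; last by move=> *; exact: abse_ge0.
  under eq_integral do rewrite abse_EFin ger0_norm//.
  by rewrite -E lee_fin.
have mkE : measurable_fun setT (fun x => (k x)%:E) by exact/measurable_EFinP.
move=> /(ae_eq_integral_abs mu measurableT mkE) kae.
apply: filterS kae => x kx Bx; have : k x = 0 by have [] := kx I.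
move=> /eqP; rewrite /k indicE mem_set// mul1r.
rewrite mulf_eq0 [W x == 0]gt_eqF// orbF => /eqP /dphubM_eq0 /eqP.
by rewrite subr_eq0 => /eqP.
Qed.

End pairing.

(** * Weak closedness of sets closed in probability *)

Section weak_closure.
Context d (T : measurableType d) (R : realType) (mu : probability T R).
Local Notation L0 := (L0 mu).
Implicit Types (f g h : L0) (K A F : set L0).

(** First-order condition at a minimum. The subgradient at the moved point [a + t * b] bounds the
    increment of the cost by [t] times the integral of [dphub (a + t * b) * (b * W)], which is thus
    nonnegative. Dominated convergence, with bound [|b * W|], lets [t] tend to 0. *)
Lemma phub_variational_inequality (a b W : T -> R) :
  measurable_fun setT a -> measurable_fun setT b -> measurable_fun setT W ->
  (forall x, 0 < W x) ->
  (\int[mu]_x (phub (a x) * W x)%:E < +oo)%E ->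
  mu.-integrable setT (EFin \o (fun x => b x * W x)) ->
  (forall t : R, 0 < t < 1 -> (\int[mu]_x (phub (a x) * W x)%:E <=
     \int[mu]_x (phub (a x + t * b x) * W x)%:E)%E) ->
  (0 <= \int[mu]_x (dphub (a x) * (b x * W x))%:E)%E.
Proof.
move=> ma mb mW W0 fin ibW min.
have mbW : measurable_fun setT (fun x => b x * W x) by exact: measurable_funM.
have mc t : measurable_fun setT (fun x => a x + t * b x).
  by apply: measurable_funD => //; exact: measurable_funM.
have mphW c : measurable_fun setT c -> measurable_fun setT (fun x => phub (c x) * W x).
  by move=> h; apply: measurable_funM => //; exact: measurable_phub h.
have mdp c : measurable_fun setT c ->
    measurable_fun setT (fun x => dphub (c x) * (b x * W x)).
  by move=> h; apply: measurable_funM => //; exact: measurable_dphub h.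
have dple c x : `|dphub c * (b x * W x)| <= `|b x * W x|.
  by rewrite normrM ler_piMl// normr_dphub_le1.
have idp c : measurable_fun setT c ->
    mu.-integrable setT (EFin \o (fun x => dphub (c x) * (b x * W x))).
  move=> h; apply: (le_integrable measurableT _ _ ibW).
    by apply/measurable_EFinP; exact: mdp.
  by move=> x _ /=; rewrite lee_fin.
have phW0 c x : 0 <= phub c * W x by rewrite mulr_ge0 ?phub_ge0// ltW.
have iph : mu.-integrable setT (EFin \o (fun x => phub (a x) * W x)).
  apply/integrableP; split; first by apply/measurable_EFinP; exact: mphW.
  apply: le_lt_trans fin; apply: ge0_le_integral => //=.
  - by apply/measurable_EFinP; apply: measurableT_comp => //; exact: mphW.
  - by apply/measurable_EFinP; exact: mphW.
  - by move=> x _; rewrite ger0_norm.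
have step (t : R) : 0 < t < 1 ->
    (0 <= \int[mu]_x (dphub (a x + t * b x) * (b x * W x))%:E)%E.
  move=> t01; have /andP[t0 t1] := t01.
  have iI := idp _ (mc t).
  have : (\int[mu]_x (phub (a x) * W x)%:E <= \int[mu]_x (phub (a x) * W x
      + t * (dphub (a x + t * b x) * (b x * W x)))%:E)%E.
    apply: le_trans (min t t01) _.
    have le x : phub (a x + t * b x) * W x <=
        phub (a x) * W x + t * (dphub (a x + t * b x) * (b x * W x)).
      have := phub_subgradient (a x + t * b x) (a x).
      rewrite -(ler_pM2r (W0 x)); lra.
    apply: ge0_le_integral => //=.
    - by move=> x _; rewrite lee_fin.
    - by apply/measurable_EFinP; exact: mphW (mc t).
    - apply/measurable_EFinP; apply: measurable_funD; first exact: mphW.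
      by apply: measurable_funM => //; exact: mdp (mc t).
    - by move=> x _; rewrite lee_fin.
  rewrite integralD_EFin//; last first.
    exact: eq_integrable (integrableZl measurableT t iI).
  have -> : (\int[mu]_x (t * (dphub (a x + t * b x) * (b x * W x)))%:E =
      t%:E * \int[mu]_x (dphub (a x + t * b x) * (b x * W x))%:E)%E.
    by rewrite -integralZl.
  rewrite -(fineK (integrable_fin_num measurableT iI)) -(fineK (integrable_fin_num measurableT iph)).
  by rewrite -EFinM -EFinD !lee_fin lerDl pmulr_rge0.
(* The steps [1 / (n + 2)] stay strictly inside the unit interval from [n = 0] on. *)
pose f_ n x := (dphub (a x + (n.+2)%:R^-1 * b x) * (b x * W x))%:E.
have [|||||_ _ cv] := @dominated_convergence _ _ _ mu setT measurableT f_
    (fun x => (dphub (a x) * (b x * W x))%:E) (fun x => `|b x * W x|%:E).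
- by move=> n; apply/measurable_EFinP; exact: mdp (mc _).
- by apply/measurable_EFinP; exact: mdp.
- apply: nearW => x _; apply/fine_cvgP; split; first exact: nearW.
  apply: cvgM; last exact: cvg_cst.
  apply: continuous_cvg; first exact: continuous_dphub.
  rewrite -[X in _ --> X]addr0; apply: cvgD; first exact: cvg_cst.
  rewrite -(mul0r (b x)); apply: cvgM; last exact: cvg_cst.
  have := @cvg_harmonic R; rewrite -(cvg_shiftn 1); apply: cvg_trans.
  by apply: near_eq_cvg; apply: nearW => n /=; rewrite /harmonic/= addn1.
- exact: integrable_abse ibW.
- by apply: nearW => x n _; rewrite /f_ /= lee_fin.
apply: (cvge_ge _ cv); apply: nearW => n; apply: step.
by rewrite invr_gt0 ltr0n/= invf_lt1 ?ltr1n ?ltr0n.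
Qed.

(** The approximation hypothesis treats one functional at a time, which is weaker than lying in the
    weak closure. It suffices since only the functional built from the minimizer is tested, apart
    from one use showing that [A] is inhabited. *)
Lemma weak_closure_in_prob K F A l (x0 : L0) :
  absolutely_convex K -> bounded_in_prob K ->
  F `<=` EK' K -> solid_in (EK' K) F -> has_strictly_positive F ->
  0 < l -> A `<=` scale_set l K -> scale_set l K x0 ->
  Defs.convex_set A -> closed_in_prob A ->
  (forall g, F g -> forall e : R, 0 < e -> exists2 h, A h & `|pair h g - pair x0 g| < e) ->
  A x0.
Proof.
move=> cK bK FK sF [w [Fw w0]] l0 AB Bx0 cA clA app.
have [W [mW W0 W1 Ww]] := positive_weight w0.
have [w' Fw' w'W] := solid_exists FK sF Fw mW Ww.
have EKA h : A h -> EK K h by move=> /AB; exact: scale_set_EK.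
have EKx : EK K x0 := scale_set_EK Bx0.
have sub := (span_subspace K).2.
have EKB f g : EK K f -> EK K g -> EK K (f - g).
  by move=> Kf Kg; rewrite addrC -scaleN1r; exact: sub.
have fin f g : EK K f -> F g -> (abs_pair f g < +oo)%E.
  by move=> Kf Fg; apply: abs_pair_lty Kf _; exact: FK.
have pB f g k : EK K f -> EK K g -> F k -> pair (f - g) k = pair f k - pair g k.
  move=> Kf Kg Fk; rewrite addrC -scaleN1r pairDZ ?fin//; lra.
have mfn f := @fn_measurable _ _ _ mu f.
have mfnB f g : measurable_fun setT (fun x => fn f x - fn g x) by exact: measurable_funB.
have iB f g : EK K f -> EK K g ->
    mu.-integrable setT (EFin \o (fun x => (fn f x - fn g x) * W x)).
  move=> Kf Kg; apply/integrableP; split.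
    by apply/measurable_EFinP; exact: measurable_funM.
  apply: le_lt_trans (fin _ _ (EKB _ _ Kf Kg) Fw').
  apply: ae_ge0_le_integral => //=.
  - by apply/measurable_EFinP; apply: measurableT_comp => //; exact: measurable_funM.
  - exact: measurable_abs_fnM.
  - by apply: filterS2 w'W (fnB f g) => x -> -> _.
(* The cost is finite since [phub t <= 1 + |t|], [W <= 1], and [W] represents an element of [F]. *)
have [h1 Ah1 Jh1] : exists2 h1, A h1 & (phub_cost W x0 h1 < +oo)%E.
  have [h1 Ah1 _] := app _ Fw 1 ltr01; exists h1 => //.
  have /integrableP[_ i1] := iB _ _ (EKA _ Ah1) EKx.
  apply: (@le_lt_trans _ _ (\int[mu]_x (1 + `|(fn h1 x - fn x0 x) * W x|)%:E)%E).
    apply: ge0_le_integral => //=.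
    - by move=> x _; rewrite lee_fin; apply: phub_integrand_ge0.
    - by apply/measurable_EFinP; exact: measurable_phub_integrand.
    - apply/measurable_EFinP; apply: measurable_funD => //.
      by apply: measurableT_comp => //; exact: measurable_funM.
    - move=> x _; rewrite lee_fin /phub_integrand normrM (gtr0_norm (W0 x)).
      have := phub_le (fn h1 x - fn x0 x); have := W1 x.
      rewrite -(ler_pM2r (W0 x)); have := W0 x; nra.
  under eq_integral do rewrite EFinD.
  rewrite ge0_integralD//=; last first.
    by apply/measurable_EFinP; apply: measurableT_comp => //; exact: measurable_funM.
  rewrite integral_cst// mul1e lte_add_pinfty//.
  by rewrite (le_lt_trans (probability_le1 mu measurableT))// ltry.
have [h Ah hmin] : exists2 h, A h &
    forall h', A h' -> (phub_cost W x0 h <= phub_cost W x0 h')%E.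
  apply: (exists_minimizer mW W0 (bounded_in_prob_scale l0 bK) AB) => //.
  by exists h1.
pose a x := fn h x - fn x0 x.
have ma0 : measurable_fun setT a := mfnB h x0.
have ma : measurable_fun setT (fun x => dphub (a x)).
  exact: (measurable_dphub (mfnB h x0)).
have [g Fg gE] : exists2 g, F g & {ae mu, forall x, fn g x = dphub (a x) * W x}.
  apply: (solid_exists FK sF Fw').
    exact: measurable_funM.
  apply: filterS w'W => x ->; rewrite normrM ler_piMl//; exact: normr_dphub_le1.
have Jfin : (phub_cost W x0 h < +oo)%E := le_lt_trans (hmin _ Ah1) Jh1.
(* The first-order condition in the direction [h' - h] says that [h] also minimizes the linear
   functional [pair _ g] over [A]. *)
have opt h' : A h' -> pair h g <= pair h' g.
  move=> Ah'; rewrite -subr_ge0 -pB//; [|exact: EKA..].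
  rewrite -lee_fin (pairE (k := fun x => dphub (a x) * ((fn h' x - fn h x) * W x))).
  - apply: phub_variational_inequality => //; first exact: (iB _ _ (EKA _ Ah') (EKA _ Ah)).
    move=> t /andP[t0 t1].
    have t01 : 0 <= t <= 1 by rewrite !ltW.
    apply: le_trans (hmin _ (cA _ _ t Ah' Ah t01)) _.
    apply: ae_ge0_le_integral => //=.
    + by move=> x _; rewrite lee_fin; apply: phub_integrand_ge0.
    + by apply/measurable_EFinP; exact: measurable_phub_integrand.
    + by move=> x _; rewrite lee_fin mulr_ge0 ?phub_ge0// ltW.
    + apply/measurable_EFinP; apply: measurable_funM => //.
      apply: (measurable_phub (f := fun x => a x + t * (fn h' x - fn h x))).
      by apply: measurable_funD => //; exact: measurable_funM.
    + have := fn_add (L0scale t h') (L0scale (1 - t) h).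
      have := fn_scale t h'; have := fn_scale (1 - t) h.
      apply: filterS3 => x E1 E2 E3 _; rewrite lee_fin /phub_integrand E3 E1 E2 /a.
      rewrite (_ : t * fn h' x + (1 - t) * fn h x - fn x0 x =
        fn h x - fn x0 x + t * (fn h' x - fn h x))//; ring.
  - exact/fin/Fg/EKB/EKA/Ah/EKA.
  - by apply: measurable_funM => //; exact: measurable_funM.
  - by apply: filterS2 gE (fnB h' h) => x -> ->; ring.
(* Otherwise a point of [A] close enough to [x0] for [g] would have a smaller pairing than [h]. *)
have le0 : pair (h - x0) g <= 0.
  rewrite pB//; last exact: EKA.
  rewrite leNgt; apply/negP => gt0.
  have [h' Ah' lt] := app _ Fg _ gt0.
  have := opt _ Ah'; move: lt; rewrite ltr_norml; lra.
suff -> : x0 = h by [].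
apply/esym/eq_L0_ae.
apply: filterS (pair_dphub_le0 (W := W) (B := setT) _ _ _ _ _ le0) => //.
- by move=> x; exact.
- exact/fin/Fg/EKB/EKx/EKA.
- by apply: filterS gE => x ->; rewrite indicT mul1r.
Qed.

End weak_closure.

(** * Weak convergence of sequences converging in probability *)

Section Koethe.
Context d (T : measurableType d) (R : realType) (mu : probability T R).
Local Notation L0 := (L0 mu).
Implicit Types (f g h : L0) (K A F : set L0) (tau : set (set L0)).

Lemma weak_top_nbhs X F f g (e : R) : F g ->
  weak_top X F [set h | X h /\ `|pair h g - pair f g| < e].
Proof.
move=> Fg; split=> [h []//|h [Xh lt]].
exists [:: g], (e - `|pair h g - pair f g|); split.
- by move=> k; rewrite inE => /eqP ->.
- by rewrite subr_gt0.
move=> k [Xk H]; split => //; have := H g (mem_head _ _).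
have := ler_normD (pair k g - pair h g) (pair h g - pair f g).
rewrite addrA subrK; lra.
Qed.

Lemma induced_nbhs K F tau B f g (e : R) : induces K F tau -> K_bounded K B ->
  EK K f -> B f -> F g -> 0 < e -> exists U, [/\ tau U, U f &
    forall h, U h -> B h -> `|pair h g - pair f g| < e].
Proof.
move=> [_ _ _ _ ind] BK Kf Bf Fg e0.
have : trace tau B ([set h | EK K h /\ `|pair h g - pair f g| < e] `&` B).
  by rewrite ind//; exists [set h | EK K h /\ `|pair h g - pair f g| < e] => //;
    exact: weak_top_nbhs.
case=> U tU UB; exists U; split => //.
  have : (U `&` B) f by rewrite UB; split => //=; rewrite subrr normr0.
  by case.
move=> h Uh Bh; have : (U `&` B) h by [].
by rewrite UB => -[[]].
Qed.

(** Without a cluster point, [A] is covered by open sets that the sequence eventually leaves; a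
    finite subcover would then miss some [v n]. *)
Lemma compact_cluster tau A (v : nat -> L0) : compact_in tau A ->
  (forall n, A (v n)) ->
  exists2 h, A h & forall U, tau U -> U h ->
    forall N, exists2 n, (N <= n)%N & U (v n).
Proof.
move=> cA Av; apply: contrapT => nex.
pose S := [set U | tau U /\ exists N, forall n, (N <= n)%N -> ~ U (v n)].
have [| |S' [/finite_setP finS' S'S cov]] := cA S; first by move=> U [].
  move=> h Ah; apply: contrapT => nh; apply: nex; exists h => // U tU Uh N.
  apply: contrapT => nn; apply: nh; exists U => //; split => //; exists N => n Nn Un.
  by apply: nn; exists n.
have [M HM] : exists M, forall n, (M <= n)%N -> forall U, S' U -> ~ U (v n).
  have : finite_set S' by exact/finite_setP.
  move=> /finite_seqP[s S's].
  have sS U : U \in s -> S U by move=> Us; apply: S'S; rewrite S's.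
  rewrite S's; elim: s sS {S's} => [|U s IH] sS; first by exists 0%N.
  have [|M HM] := IH; first by move=> V Vs; apply: sS; rewrite inE Vs orbT.
  have [_ [N HN]] := sS U (mem_head _ _).
  exists (maxn M N) => n; rewrite geq_max => /andP[Mn Nn] V /=.
  by rewrite inE => /orP[/eqP ->|Vs]; [exact: HN|exact: HM].
by have [U SU Uv] := cov _ (Av M); exact: HM (leqnn M) _ SU Uv.
Qed.

Lemma le_expr_half (e : R) : 0 < e -> exists N, forall n, (N <= n)%N -> 2^-1 ^+ n < e.
Proof.
move=> e0.
have half : `|2^-1 : R| < 1 by rewrite ger0_norm// invf_lt1// ltr1n.
have /cvgrPdist_lt /(_ e e0) [N _ HN] := cvg_expr half.
by exists N => n /HN; rewrite /= sub0r normrN ger0_norm ?exprn_ge0.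
Qed.

(* No uniform integrability is needed: compactness gives a cluster point of any
   fast subsequence, and testing it against functionals supported where the
   subsequence converges uniformly identifies it with the limit in
   probability. *)
Lemma compact_pair_cvg K F tau (u : nat -> L0) f g :
  absolutely_convex K -> closed_in_prob K -> compact_in tau K -> induces K F tau ->
  (forall n, K (u n)) -> cvg_in_prob u f -> F g ->
  (fun n => pair (u n) g) @ \oo --> pair f g.
Proof.
move=> cK clK cpt ind uK uf Fg.
have [FK sF _ [w [Fw w0]] _] := ind.
have Kf : K f := clK _ _ uK uf.
have [W [mW W0 W1 Ww]] := positive_weight w0.
have KB : K_bounded K K.
  by exists 1; split => // h Kh; apply/scale_setP; rewrite ?invr1 ?scale1r.
have KE h : K h -> EK K h by exact: subset_span.
have fin h k : EK K h -> F k -> (abs_pair h k < +oo)%E.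
  by move=> Kh Fk; apply: abs_pair_lty Kh _; exact: FK.
have EKB h k : EK K h -> EK K k -> EK K (h - k).
  by move=> Kh Kk; rewrite addrC -scaleN1r; exact: (span_subspace K).2.
have pB h h' k : EK K h -> EK K h' -> F k -> pair (h - h') k = pair h k - pair h' k.
  move=> Kh Kh' Fk; rewrite addrC -scaleN1r pairDZ ?fin//; lra.
apply: contrapT => ncv.
have [e e0 far] : exists2 e : R, 0 < e &
    forall N, exists2 n, (N <= n)%N & e <= `|pair (u n) g - pair f g|.
  apply: contrapT => nex; apply: ncv; apply/cvgrPdist_lt => e e0.
  apply: contrapT => nn; apply: nex; exists e => // N.
  apply: contrapT => nN; apply: nn; exists N => // n /= Nn.
  rewrite distrC ltNge; apply/negP => le; apply: nN; by exists n.
have half n : 0 < (2^-1 : R) ^+ n by rewrite exprn_gt0.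
(* The indices [r k] need not increase: what matters is closeness to [f] at rate [2^-1 ^+ k] and
   pairing with [g] at distance at least [e] from the limit. *)
have /choice[r rP] : forall k, exists n,
    (mu [set x | (2^-1 ^+ k <= `|fn (u n) x - fn f x|)%R] <= (2^-1 ^+ k)%:E)%E /\
    e <= `|pair (u n) g - pair f g|.
  move=> k; have [|N _ HN] := cvg_lte (uf _ (half k)) (_ : (0 < (2^-1 ^+ k)%:E)%E).
    by rewrite lte_fin.
  by have [n Nn ?] := far N; exists n; split => //; apply/ltW/HN.
pose v k := u (r k).
pose E k := [set x | 2^-1 ^+ k <= `|fn (v k) x - fn f x|].
have mE k : measurable (E k).
  by apply: measurable_norm_ge; apply: measurable_funB; exact: fn_measurable.
have [h Kh clu] := compact_cluster cpt (fun k => uK (r k)).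
have near_h k (e' : R) : F k -> 0 < e' -> forall N, exists2 n, (N <= n)%N &
    `|pair (v n) k - pair h k| < e'.
  move=> Fk e'0 N.
  have [U [tU Uh HU]] := induced_nbhs ind KB (KE _ Kh) Kh Fk e'0.
  by have [n Nn Un] := clu _ tU Uh N; exists n => //; apply: HU => //; exact: uK.
suff hf : h = f.
  have [n _] := near_h _ _ Fg e0 0%N; rewrite hf.
  by have [_] := rP n; rewrite -/(v n) => h1 h2; move: (le_lt_trans h1 h2); rewrite ltxx.
have BC := Borel_Cantelli_geometric mE (fun k => (rP k).1).
have on_B N : {ae mu, forall x, (~` \bigcup_(n in [set n | (N <= n)%N]) E n) x ->
    fn h x = fn f x}.
  set B := ~` _.
  have mB : measurable B by apply/measurableC/bigcup_measurable => n _.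
  have mhf : measurable_fun setT (fun x => fn h x - fn f x).
    by apply: measurable_funB; exact: fn_measurable.
  (* The test function is cut off to the set [B], where [v n] is within [2^-1 ^+ n] of [f] for all
     [n >= N]. Solidity keeps it in [F], and [|k| <= 1] turns uniform closeness into closeness of
     pairings. *)
  pose k x := \1_B x * dphub (fn h x - fn f x) * W x.
  have mk : measurable_fun setT k.
    apply: measurable_funM => //; apply: measurable_funM => //.
    exact: (measurable_dphub mhf).
  have BW0 x : 0 <= \1_B x * W x by apply: mulr_ge0; [rewrite indicE|exact: ltW].
  have kle x : `|k x| <= \1_B x * W x.
    by rewrite /k mulrAC normrM (ger0_norm (BW0 x)) ler_piMr ?normr_dphub_le1.
  have k1 x : `|k x| <= W x.
    apply: le_trans (kle x) _; rewrite indicE; case: (_ \in _); first by rewrite mul1r.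
    by rewrite mul0r ltW.
  have [q Fq qk] : exists2 q, F q & {ae mu, forall x, fn q x = k x}.
    apply: (solid_exists FK sF Fw mk).
    by apply: filterS Ww => x; apply: le_trans; rewrite (gtr0_norm (W0 x)).
  apply: (pair_dphub_le0 mB mW W0 _ qk); first exact/fin/Fq/EKB/KE/Kf/KE.
  have vf n : (N <= n)%N -> `|pair (v n - f) q| <= 2^-1 ^+ n.
    move=> Nn; have Ivf : (abs_pair (v n - f)%R q < +oo)%E.
      by apply: fin => //; apply: EKB; apply: KE => //; exact: uK.
    rewrite -lee_fin; apply: le_trans (_ : _ <= abs_pair (v n - f)%R q)%E _.
      rewrite /pair EFin_normr_Rintegral//; last exact: integrable_pair.
      apply: le_abse_integral => //; apply/measurable_EFinP; exact: measurable_fnM.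
    apply: (@le_trans _ _ (\int[mu]_x (cst (2^-1 ^+ n)%:E x))%E).
      apply: ae_ge0_le_integral => //=.
      - exact: measurable_abs_fnM.
      - apply: filterS2 qk (fnB (v n) f) => x -> -> _; rewrite lee_fin.
        have [Bx|nBx] := pselect (B x); last first.
          by rewrite /k indicE memNset// !mul0r mulr0 normr0 ltW.
        rewrite normrM -[leRHS]mulr1; apply: ler_pM => //; last first.
          exact: le_trans (k1 x) (W1 x).
        rewrite leNgt; apply/negP => lt; apply: Bx; exists n => //.
        exact: ltW.
    rewrite integral_cst// -[leRHS]mule1; apply: lee_wpmul2l.
      by rewrite lee_fin ltW.
    exact: probability_le1.
  rewrite pB//; [|exact: KE..].
  (* For a large [n] at which [v n] is close to the cluster point, [pair h q] and [pair f q] are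
     both within [e' / 2] of [pair (v n) q]. *)
  apply/ler_addgt0Pr => e' e'0; rewrite add0r.
  have e2 : 0 < e' / 2 by rewrite divr_gt0.
  have [M HM] := le_expr_half e2.
  have [n nMN] := near_h _ _ Fq e2 (maxn M N).
  move: nMN; rewrite geq_max => /andP[Mn Nn].
  have := vf _ Nn; have := HM _ Mn.
  rewrite pB//; [|by apply: KE => //; exact: uK..].
  rewrite !ltr_norml !ler_norml; lra.
apply: eq_L0_ae; have := ae_foralln on_B; apply: filterS2 BC => x [N HN] H.
by apply: (H N) => -[n Nn]; exact: HN.
Qed.

Lemma pair_cvg K F tau (u : nat -> L0) f g :
  absolutely_convex K -> closed_in_prob K -> compact_in tau K -> induces K F tau ->
  K_bounded K (range u) -> cvg_in_prob u f -> F g ->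
  (fun n => pair (u n) g) @ \oo --> pair f g.
Proof.
move=> cK clK cpt ind [l [l0 ul]] uf Fg.
have uK n : K (l^-1 *: u n) by apply/(scale_setP _ _ l0)/ul; exists n.
have luf : cvg_in_prob (fun n => l^-1 *: u n) (l^-1 *: f).
  by apply: cvg_in_prob_scale => //; rewrite invr_eq0 gt_eqF.
have cv := compact_pair_cvg cK clK cpt ind uK luf Fg.
have Kf := clK _ _ uK luf.
have [FK _ _ _ _] := ind.
have scale h : K (l^-1 *: h) -> pair h g = l * pair (l^-1 *: h) g.
  move=> Kh; have fin : (abs_pair (l^-1 *: h)%R g < +oo)%E.
    by apply: abs_pair_lty (subset_span Kh) _; exact: FK.
  have fin0 : (abs_pair (0%R : L0) g < +oo)%E by rewrite abs_pairC abs_pair0 ltry.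
  have := pairDZ (-1) fin0 fin0; rewrite scaleN1r addNr => p0.
  have := pairDZ l fin fin0; rewrite scalerA divff ?gt_eqF// scale1r addr0 => ->.
  by move: p0; lra.
rewrite (scale f)//; under eq_fun do rewrite scale//.
by apply: cvgM => //; exact: cvg_cst.
Qed.

End Koethe.

(** * Affine minorants *)

Section Fenchel_Moreau.
Context d (T : measurableType d) (R : realType) (mu : probability T R).
Local Notation L0 := (L0 mu).
Implicit Types (X U : set L0) (tau : set (set L0)) (f g h : L0).

Lemma open_of_nbhs X tau (O : set L0) : is_topology_on X tau ->
  (forall f, O f -> exists U, [/\ tau U, U f & U `<=` O]) -> tau O.
Proof.
move=> [_ _ tcup _] H.
have -> : O = \bigcup_(U in [set U | tau U /\ U `<=` O]) U.
  apply/seteqP; split=> [f Of|f [U [_ UO] Uf]]; last exact: UO.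
  by have [U [? ? ?]] := H _ Of; exists U.
by apply: tcup => U [].
Qed.

Section affine_minorant.
Variables (X : set L0) (tau : set (set L0)) (phi : L0 -> \bar R) (f0 : L0) (r : R).
Hypotheses (sX : linear_subspace X) (topX : is_topology_on X tau)
  (lcX : locally_convex_on X tau) (cphi : convex_fun_on X phi)
  (pphi : proper_on X phi) (lphi : lsc_on tau X phi) (Xf0 : X f0)
  (rphi : (r%:E < phi f0)%E).

Let X0 : X 0 := sX.1.
Let XZ (a : R) f : X f -> X (a *: f).
Proof. by move=> Xf; rewrite -[_ *: _]addr0; apply: sX.2. Qed.
Let XD f g : X f -> X g -> X (f + g).
Proof. by move=> Xf Xg; rewrite -[f]scale1r; apply: sX.2. Qed.
Let XN f : X f -> X (- f).
Proof. by move=> Xf; rewrite -scaleN1r; exact: XZ. Qed.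

Let D f := X f /\ (phi f < +oo)%E.
Let phir f := fine (phi f).

Let phirE f : D f -> phi f = (phir f)%:E.
Proof.
move=> [Xf lt]; rewrite /phir fineK// fin_numE pphi.1// lt_eqF//.
Qed.

Let D_convex f g (t : R) : D f -> D g -> 0 < t < 1 ->
  D (t *: f + (1 - t) *: g) /\
  phir (t *: f + (1 - t) *: g) <= t * phir f + (1 - t) * phir g.
Proof.
move=> Df Dg t01; have := cphi Df.1 Dg.1 t01.
rewrite L0addE !L0scaleE (phirE Df) (phirE Dg) -!EFinM -EFinD => le.
have Dc : D (t *: f + (1 - t) *: g).
  split; first by apply: XD; apply: XZ; [exact: Df.1|exact: Dg.1].
  by apply: le_lt_trans le _; rewrite ltry.
by split => //; rewrite -lee_fin -phirE.
Qed.

Let lsc_nbhs f (s : R) : X f -> (s%:E < phi f)%E ->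
  exists U, [/\ tau U, U 0 & forall u, U u -> (s%:E < phi (f + u)%R)%E].
Proof.
move=> Xf sf; have [_ tO] := lphi s.
have [add _ _] := lcX.
have [|U [V [_ tV Uf V0 UV]]] := add f 0 _ Xf X0 tO.
  by rewrite L0addE addr0; split => // -[_]; rewrite leNgt sf.
by exists V; split => // u /(UV _ _ Uf)[Xfu nle]; rewrite ltNge; apply/negP => ?; exact: nle.
Qed.

(** A single convex [U] serves two purposes: around [f0] it keeps [phi] above [r], and around a
    point [y0] of finiteness it will bound [phi] below, so that the infimal convolution is
    finite. *)
Let convex_nbhs y0 (s : R) : X y0 -> (s%:E < phi y0)%E -> exists U, [/\ tau U, U 0,
   (forall f g (t : R), U f -> U g -> 0 <= t <= 1 -> U (t *: f + (1 - t) *: g)),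
   (forall u, U u -> (r%:E < phi (f0 + u)%R)%E) &
   (forall u, U u -> (s%:E < phi (y0 + u)%R)%E)].
Proof.
move=> Xy0 sy; have [V [tV V0 HV]] := lsc_nbhs Xf0 rphi.
have [V' [tV' V0' HV']] := lsc_nbhs Xy0 sy.
have [_ _ _ tcap] := topX; have [_ _ lc] := lcX.
have [|U [tU U0 UV cU]] := lc _ (tcap _ _ tV tV'); first by [].
exists U; split => // u /UV[Vu V'u]; [exact: HV|exact: HV'].
Qed.

Lemma lsc_affine_minorant : exists ell : L0 -> R,
  [/\ linear_on X ell, continuous_on tau X ell &
    forall y, X y -> ((r + ell y - ell f0)%:E <= phi y)%E].
Proof.
have [y0 [Xy0 ltyy]] := pphi.2; have Dy0 : D y0 by [].
pose s := phir y0.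
have sy : ((s - 1)%:E < phi y0)%E by rewrite (phirE Dy0) lte_fin gtrBl.
have [U [tU U0 cU Uf0 Uy0]] := convex_nbhs Xy0 sy.
have [addc scac _] := lcX.
(* For [t > 0], [U (t^-1 *: a)] plays the role of a gauge of [a] at most [t]; [Umono] and [Uadd] are
   monotonicity and subadditivity. [U] is not assumed symmetric, so [a] and [- a] are kept apart. *)
have Umono t t' a : 0 < t -> t <= t' -> U (t^-1 *: a) -> U (t'^-1 *: a).
  move=> t0 tt' Ua; have t'0 := lt_le_trans t0 tt'.
  have -> : t'^-1 *: a = (t / t') *: (t^-1 *: a) + (1 - t / t') *: 0.
    by rewrite scaler0 addr0 scalerA mulrAC divff ?gt_eqF// mul1r.
  by apply: cU => //; rewrite ltW ?divr_gt0//= ler_pdivrMr// mul1r.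
have Uadd t t' a b : 0 < t -> 0 < t' -> U (t^-1 *: a) -> U (t'^-1 *: b) ->
    U ((t + t')^-1 *: (a + b)).
  move=> t0 t'0 Ua Ub; have tt0 : 0 < t + t' by exact: addr_gt0.
  have E : 1 - t / (t + t') = t' / (t + t') by field; rewrite gt_eqF.
  have -> : (t + t')^-1 *: (a + b) =
      (t / (t + t')) *: (t^-1 *: a) + (1 - t / (t + t')) *: (t'^-1 *: b).
    rewrite E scalerDr !scalerA !(mulrAC _ (t + t')^-1) !divff ?gt_eqF//.
    by rewrite !mul1r.
  apply: cU => //; rewrite ltW ?divr_gt0//= ler_pdivrMr// mul1r lerDl ltW//.
have absorb a : X a -> exists2 t, 1 <= t & U (t^-1 *: a).
  move=> Xa; have [|del [V [del0 _ Va HV]]] := scac 0 a U Xa tU.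
    by rewrite L0scaleE scale0r.
  exists (Num.max 1 (2 / del)); first by rewrite le_max lexx.
  apply: (@Umono (2 / del)); rewrite ?divr_gt0//; first by rewrite le_max lexx orbT.
  rewrite -L0scaleE; apply: HV => //; rewrite subr0 gtr0_norm ?invr_gt0 ?divr_gt0//.
  by rewrite invf_div ltr_pdivrMr// ltr_pMr// ltr1n.
(* The point [y0 + rho^-1 *: (y - y0)] lies in [y0 + U], where [phi > s - 1]. Convexity carries this
   bound out to [y], at a cost linear in the gauge. *)
have low y rho : D y -> 1 < rho -> U (rho^-1 *: (y - y0)) -> s - rho <= phir y.
  move=> Dy rho1 Uy; have rho0 : 0 < rho by rewrite (lt_trans _ rho1).
  have i01 : 0 < rho^-1 < 1 by rewrite invr_gt0 rho0 invf_lt1.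
  have [Dz] := D_convex Dy Dy0 i01.
  have zE : rho^-1 *: y + (1 - rho^-1) *: y0 = y0 + rho^-1 *: (y - y0).
    by rewrite scalerBl scale1r scalerBr addrCA addrA.
  have := Uy0 _ Uy; rewrite -zE (phirE Dz) lte_fin -/s => lt1 lt2.
  have : rho * (s - 1) <= rho * (rho^-1 * phir y + (1 - rho^-1) * s).
    by rewrite ler_pM2l// ltW// (lt_le_trans lt1).
  have -> : rho * (rho^-1 * phir y + (1 - rho^-1) * s) = phir y + rho * s - s.
    by field; rewrite gt_eqF.
  by lra.
have [c0 c01 Uc0] := absorb _ (XD Xf0 (XN Xy0)).
(* [N >= 1] offsets the linear decrease of [phi], so the infimal convolution is bounded below. The
   second bound makes its value at [f0] at least [r] when the gauge term exceeds 1; below 1, the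
   choice of [U] around [f0] does. *)
pose N := Num.max 1 (r - s + c0 + 1).
have N1 : 1 <= N by rewrite le_max lexx.
have N2 : r - s + c0 + 1 <= N by rewrite le_max lexx orbT.
(* [psi] is the infimal convolution of [phi] with [N] times the gauge of [U]. *)
pose S x := [set v | exists y t, [/\ D y, 0 < t, U (t^-1 *: (y - x)) &
  v = phir y + N * t]].
pose psi x := inf (S x).
have Slow x c y t : D y -> 0 < t -> U (t^-1 *: (y - x)) -> 1 <= c ->
    U (c^-1 *: (x - y0)) -> s - c - t <= phir y.
  move=> Dy t0 Uy c1 Ux; have c0' : 0 < c by exact: lt_le_trans c1.
  have := low y (t + c) Dy; have -> : y - y0 = (y - x) + (x - y0) by rewrite addrA subrK.
  move=> /(_ _ (Uadd _ _ _ _ t0 c0' Uy Ux)); lra.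
have infS x : X x -> has_inf (S x).
  move=> Xx; split.
    have [t t1 Ut] := absorb _ (XD Xy0 (XN Xx)).
    by exists (phir y0 + N * t), y0, t; split => //; rewrite (lt_le_trans _ t1).
  have [c c1 Uc] := absorb _ (XD Xx (XN Xy0)).
  exists (s - c) => _ [y [t [Dy t0 Uy ->]]].
  have := Slow _ _ _ _ Dy t0 Uy c1 Uc; nra.
have psi_le x y t : X x -> D y -> 0 < t -> U (t^-1 *: (y - x)) ->
    psi x <= phir y + N * t.
  by move=> Xx Dy t0 Uy; apply: ge_inf; [exact: (infS _ Xx).2|exists y, t].
have psi_ge x v : X x -> (forall y t, D y -> 0 < t -> U (t^-1 *: (y - x)) ->
    v <= phir y + N * t) -> v <= psi x.
  move=> Xx H; apply: lb_le_inf; first exact: (infS _ Xx).1.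
  by move=> _ [y [t [Dy t0 Uy ->]]]; exact: H.
have psif0 : r <= psi f0.
  apply: psi_ge => // y t Dy t0 Uy.
  have [t1|/ltW t1] := leP t 1.
    have := Umono _ _ _ t0 t1 Uy; rewrite invr1 scale1r => /Uf0.
    rewrite addrC subrK (phirE Dy) lte_fin; nra.
  have := Slow _ _ _ _ Dy t0 Uy c01 Uc0; nra.
have psi_convex : convex_real_on X psi.
  move=> x1 x2 l Xx1 Xx2 l01; have /andP[l0 l1] := l01.
  have l1' : 0 < 1 - l by rewrite subr_gt0.
  apply/ler_addgt0Pr => e e0.
  have [_ [y1 [t1 [Dy1 t10 Uy1 ->]]] lt1] := inf_adherent e0 (infS _ Xx1).
  have [_ [y2 [t2 [Dy2 t20 Uy2 ->]]] lt2] := inf_adherent e0 (infS _ Xx2).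
  have [Dy le] := D_convex Dy1 Dy2 l01.
  have lt10 : 0 < l * t1 by exact: mulr_gt0.
  have lt20 : 0 < (1 - l) * t2 by exact: mulr_gt0.
  have Uy : U ((l * t1 + (1 - l) * t2)^-1 *:
      ((l *: y1 + (1 - l) *: y2) - (l *: x1 + (1 - l) *: x2))).
    have -> : (l *: y1 + (1 - l) *: y2) - (l *: x1 + (1 - l) *: x2) =
        l *: (y1 - x1) + (1 - l) *: (y2 - x2).
      by rewrite !scalerBr opprD addrACA.
    apply: Uadd => //.
      by rewrite scalerA invfM mulrAC mulVf ?gt_eqF// mul1r.
    by rewrite scalerA invfM mulrAC mulVf ?gt_eqF// mul1r.
  have Xx : X (l *: x1 + (1 - l) *: x2) by apply: XD; exact: XZ.
  apply: le_trans (psi_le _ _ _ Xx Dy (addr_gt0 lt10 lt20) Uy) _.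
  by rewrite -/(psi x1) in lt1; rewrite -/(psi x2) in lt2; nra.
have psi_shift h t : X h -> 0 < t -> U (t^-1 *: (- h)) ->
    psi (f0 + h) - psi f0 <= N * t.
  move=> Xh t0 Uh; rewrite lerBlDl -lerBlDr; apply: psi_ge => // y t' Dy t'0 Uy.
  rewrite lerBlDr -addrA -mulrDr; apply: psi_le => //; first exact: XD.
    exact: addr_gt0.
  by rewrite opprD addrA; exact: Uadd.
have psi_phi y : D y -> psi y <= phir y.
  move=> Dy; apply/ler_addgt0Pr => e e0.
  have N0 : 0 < N by exact: lt_le_trans N1.
  have -> : e = N * (e / N) by rewrite mulrCA divff ?gt_eqF// mulr1.
  apply: psi_le => //; first exact: Dy.1; first exact: divr_gt0.
  by rewrite subrr scaler0.
(* Dominating [ell] by the increment of [psi] at [f0] makes it a subgradient there; the majorant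
   vanishes at 0. *)
have [||ell [ellL ellp]] := @Hahn_Banach R L0 X (fun h => psi (f0 + h) - psi f0) sX.
- move=> x1 x2 l Xx1 Xx2 l01.
  have := psi_convex (f0 + x1) (f0 + x2) l (XD Xf0 Xx1) (XD Xf0 Xx2) l01.
  have -> : l *: (f0 + x1) + (1 - l) *: (f0 + x2) = f0 + (l *: x1 + (1 - l) *: x2).
    rewrite !scalerDr addrACA -scalerDl (_ : l + (1 - l) = 1) ?scale1r//.
    by ring.
  lra.
- by rewrite addr0 subrr.
have ell0 : ell 0 = 0.
  by have := ellL (-1) 0 0 X0 X0; rewrite scaler0 addr0; lra.
have ellZ a x : X x -> ell (a *: x) = a * ell x.
  by move=> Xx; have := ellL a x 0 Xx X0; rewrite addr0 ell0 addr0.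
have ellB x y : X x -> X y -> ell (x - y) = ell x - ell y.
  move=> Xx Xy; have := ellL (-1) y x Xy Xx.
  by rewrite scaleN1r addrC => ->; lra.
have ell_le x t : X x -> 0 < t -> U (t^-1 *: - x) -> ell x <= N * t.
  by move=> Xx t0 Ux; apply: le_trans (ellp _ Xx) _; exact: psi_shift.
exists ell; split.
- move=> f g a b Xf Xg; rewrite L0addE !L0scaleE ellL//; last exact: XZ.
  by rewrite ellZ.
- move=> V oV; apply: (open_of_nbhs topX) => f [Xf Vf].
  have [_ tsub _ tcap] := topX.
  have /nbhs_ballP[e /= e0 eV] := open_nbhs_nbhs (conj oV Vf : open_nbhs (ell f) V).
  pose t := e / (2 * N).
  have N0 : 0 < N by exact: lt_le_trans N1.
  have t0 : 0 < t by rewrite divr_gt0// mulr_gt0.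
  have Nt : N * t < e.
    have -> : N * t = e / 2 by rewrite /t; field; rewrite gt_eqF.
    by lra.
  (* Bounding [ell] on both sides needs [U] at both [t^-1] and [- t^-1] times the increment, hence
     the two neighbourhoods [W1] and [W2]. *)
  have [|del1 [W1 [d10 tW1 W10 HW1]]] := scac t^-1 0 U X0 tU.
    by rewrite L0scaleE scaler0.
  have [|del2 [W2 [d20 tW2 W20 HW2]]] := scac (- t^-1) 0 U X0 tU.
    by rewrite L0scaleE scaler0.
  have [|Q [Q' [tQ tQ' Qf Q'f HQ]]] := addc f (- f) _ Xf (XN Xf) (tcap _ _ tW1 tW2).
    by rewrite L0addE subrr.
  exists Q; split => // h Qh; have Xh := tsub _ tQ _ Qh; split => //.
  have [W1h W2h] := HQ _ _ Qh Q'f; rewrite L0addE in W1h W2h.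
  apply: eV; rewrite /ball/= distrC -ellB// ltr_norml; apply/andP; split.
    rewrite ltrNl -mulN1r -ellZ ?scaleN1r; last by apply: XD => //; exact: XN.
    apply: le_lt_trans Nt; apply: ell_le => //; first by apply/XN/XD/XN.
    by rewrite opprK -L0scaleE; apply: HW1 => //; rewrite subrr normr0.
  apply: le_lt_trans Nt; apply: ell_le => //; first by apply/XD/XN.
  by rewrite scalerN -scaleNr -L0scaleE; apply: HW2 => //; rewrite subrr normr0.
- move=> y Xy; have [->|ny] := eqVneq (phi y) +oo%E; first exact: leey.
  have lty : (phi y < +oo)%E by rewrite lt_neqAle ny leey.
  have Dy : D y by [].
  rewrite (phirE Dy) lee_fin; have := psi_phi _ Dy.
  have := ellp _ (XD Xy (XN Xf0)); rewrite ellB// [f0 + _]addrC subrK.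
  by move: psif0; lra.
Qed.

End affine_minorant.
End Fenchel_Moreau.

(** * Conjugate duality, the Fatou property and the equivalence *)

Section equivalence.
Context d (T : measurableType d) (R : realType) (mu : probability T R).
Local Notation L0 := (L0 mu).
Implicit Types (K F : set L0) (tau : set (set L0)) (phi : L0 -> \bar R).

Lemma lee_fin_lower (x y : \bar R) : x != -oo%E ->
  (forall r, (r%:E < x)%E -> (r%:E <= y)%E) -> (x <= y)%E.
Proof.
case: x => [a| |] // _ H; last by rewrite (eq_infty (x := y))// => r; exact/H/ltry.
apply/lee_subgt0Pr => e e0; rewrite -EFinB; apply: H; rewrite lte_fin; lra.
Qed.

Lemma Fenchel_Young X phi f g : X f -> phi f != -oo%E ->
  ((pair f g)%:E - conjugate X phi g <= phi f)%E.
Proof.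
move=> Xf; have : ((pair f g)%:E - phi f <= conjugate X phi g)%E.
  by apply: ereal_sup_ubound; exists f.
case: (phi f) (conjugate X phi g) => [a| |] [c| |]//=; rewrite ?leey ?leNye//.
by rewrite -!EFinB !lee_fin; lra.
Qed.

(** An affine minorant of slope [g] with value [r] at [f] says exactly that the conjugate at [g] is
    at most [pair f g - r]; the other inequality is Fenchel-Young. *)
Lemma conjugate_dual X phi F f : X f -> phi f != -oo%E ->
  (forall r : R, (r%:E < phi f)%E -> exists2 g, F g &
    forall h, X h -> ((r + pair h g - pair f g)%:E <= phi h)%E) ->
  phi f = ereal_sup [set ((pair f g)%:E - conjugate X phi g)%E | g in F].
Proof.
move=> Xf nf minor; apply/eqP; rewrite eq_le; apply/andP; split; last first.
  by apply: ge_ereal_sup => _ [g Fg <-]; exact: Fenchel_Young.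
apply: lee_fin_lower => // r /minor[g Fg Hg].
apply: (@le_trans _ _ ((pair f g)%:E - conjugate X phi g)%E); last first.
  by apply: ereal_sup_ubound; exists g.
have : (conjugate X phi g <= (pair f g - r)%:E)%E.
  apply: ge_ereal_sup => _ [h Xh <-]; have := Hg _ Xh.
  case: (phi h) => [b| |]//=; rewrite ?leNye// -EFinB !lee_fin; lra.
by case: (conjugate X phi g) => [c| |]//=; rewrite ?leey// -EFinB !lee_fin; lra.
Qed.

Lemma conjugate_dual_Fatou K F tau phi :
  absolutely_convex K -> closed_in_prob K -> compact_in tau K -> induces K F tau ->
  (forall f, EK K f -> phi f != -oo%E) ->
  (forall f, EK K f ->
     phi f = ereal_sup [set ((pair f g)%:E - conjugate (EK K) phi g)%E | g in F]) ->
  equicontinuous_Fatou K phi.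
Proof.
move=> cK clK cpt ind pphi dual u f Ku Kf uf.
rewrite dual//; apply: ge_ereal_sup => _ [g Fg <-].
have cv := pair_cvg cK clK cpt ind Ku uf Fg.
have Xu n : EK K (u n).
  by have [l [l0 ul]] := Ku; apply: (@scale_set_EK _ _ _ _ l); apply: ul; exists n.
have FY n := Fenchel_Young g (Xu n) (pphi _ (Xu n)).
(* A conjugate equal to [+oo] contributes [-oo] to the supremum; if it is [-oo], Fenchel-Young
   forces [phi (u n) = +oo] for all [n]. *)
case: (conjugate _ _ g) FY => [c| |] FY; last 2 first.
- by rewrite /= leNye.
- exact: limn_einf_ge.
have cvc : (fun n => (pair (u n) g)%:E - c%:E)%E @ \oo --> ((pair f g)%:E - c%:E)%E.
  apply/fine_cvgP; split; first exact: nearW.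
  by apply: cvgB; [exact: cv|exact: cvg_cst].
by rewrite -(cvg_limn_einf_sup cvc).1; exact: le_limn_einf.
Qed.

(** [convex_fun_on] covers only [0 < t < 1] and [convex_set] the closed interval, so the two
    endpoints are checked directly. *)
Lemma convex_sublevel X phi (r : R) : linear_subspace X -> convex_fun_on X phi ->
  Defs.convex_set [set f | X f /\ (phi f <= r%:E)%E].
Proof.
move=> [X0 XL] cphi f g t [Xf fr] [Xg gr] /andP[]; rewrite le_eqVlt => /orP[/eqP <- _|t0].
  by rewrite L0addE !L0scaleE scale0r subr0 scale1r add0r.
rewrite le_eqVlt => /orP[/eqP ->|t1].
  by rewrite L0addE !L0scaleE subrr scale0r scale1r addr0.
split; first by apply: (XL) => //; rewrite -[L0scale _ _]addr0; exact: XL.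
have t01 : 0 < t < 1 by rewrite t0.
apply: le_trans (cphi f g t Xf Xg t01) _.
apply: (@le_trans _ _ (t%:E * r%:E + (1 - t)%:E * r%:E)%E).
  by apply: leeD; apply: lee_wpmul2l => //; rewrite lee_fin ?subr_ge0 ltW.
by rewrite -!EFinM -EFinD lee_fin; lra.
Qed.

(** By [weak_closure_in_prob], a point outside [A] is kept at a positive distance from [A] by one
    functional of [F]. The resulting weak neighbourhood is turned into a [tau]-open one by
    [induced_nbhs]. *)
Lemma prob_closed_convex_closed K F tau l (A : set L0) :
  absolutely_convex K -> bounded_in_prob K -> is_topology_on (EK K) tau ->
  induces K F tau -> 0 < l -> A `<=` scale_set l K -> Defs.convex_set A ->
  closed_in_prob A -> closed_in tau (EK K) A.
Proof.
move=> cK bK top ind l0 AK cA clA.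
have [tX tsub _ _] := top; have [FK sF _ pos _] := ind.
split; first by move=> h /AK; exact: scale_set_EK.
apply: (open_of_nbhs top) => x [Xx nAx].
have [[a Aa]|/forallNP Ae] := pselect (exists a, A a); last first.
  by exists (EK K); split => // h Xh; split => // /Ae.
have [k Kk _] := AK _ Aa.
have [m' m'0 xm'] := EK_scale_set cK Kk Xx.
(* The trace identity needs one [K]-bounded set containing both [A] and [x]. *)
pose m := Num.max l m'.
have m0 : 0 < m by rewrite lt_max l0.
have Am : A `<=` scale_set m K.
  move=> h /AK; apply: scale_set_le => //; by rewrite le_max lexx.
have xm : scale_set m K x.
  by apply: scale_set_le xm' => //; rewrite le_max lexx orbT.
have [g [Fg [e e0 far]]] : exists g, F g /\ exists2 e : R, 0 < e &
    forall h, A h -> e <= `|pair h g - pair x g|.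
  apply: contrapT => nex; apply: nAx.
  apply: (weak_closure_in_prob cK bK FK sF pos m0 Am xm cA clA) => g Fg e e0.
  apply: contrapT => nh; apply: nex; exists g; split => //; exists e => // h Ah.
  by rewrite leNgt; apply/negP => lt; apply: nh; exists h.
have Bm : K_bounded K (scale_set m K) by exists m; split.

have [U [tU Ux HU]] := induced_nbhs ind Bm Xx xm Fg e0.
exists U; split => // h Uh; split; first exact: tsub tU _ Uh.
by move=> Ah; have := HU _ Uh (Am _ Ah); rewrite ltNge far.
Qed.

(** The Fatou property says that each sublevel set cut by [l K] is closed in probability, and the
    Krein-Smulian property reduces closedness of the sublevel set to these cuts. *)
Lemma Fatou_lsc K F tau phi :
  absolutely_convex K -> closed_in_prob K -> bounded_in_prob K ->
  is_topology_on (EK K) tau -> induces K F tau -> Krein_Smulian K tau ->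
  convex_fun_on (EK K) phi -> equicontinuous_Fatou K phi -> lsc_on tau (EK K) phi.
Proof.
move=> cK clK bK top ind KS cphi fatou r.
have cC := convex_sublevel (r := r) (span_subspace K) cphi.
apply/(KS _ _ cC) => [f []//|l l0].
apply: (prob_closed_convex_closed cK bK top ind l0) => [f []//||u f uA uf].
  move=> f g t [Cf Kf] [Cg Kg] t01; split; first exact: cC.
  have /andP[t0 t1] := t01.
  apply/scale_setP => //; rewrite L0addE !L0scaleE scalerDr !scalerA.
  rewrite ![l^-1 * _]mulrC -!scalerA; apply: cK.
  - exact/(scale_setP _ _ l0).
  - exact/(scale_setP _ _ l0).
  - by rewrite !ger0_norm ?subr_ge0//; lra.
have Kf : scale_set l K f.
  by apply: closed_in_prob_scale uf => // n; case: (uA n).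
have Xf := scale_set_EK Kf; split => //; split => //.
apply: le_trans (fatou u f _ Xf uf) _.
  by exists l; split => // _ [n _ <-]; case: (uA n).
rewrite -(cvg_limn_einf_sup (cvg_cst r%:E : cst r%:E @ \oo --> r%:E)).1.
by apply: le_limn_einf => n; case: (uA n) => -[].
Qed.

End equivalence.

Theorem theorem5p5 (d : measure_display) (T : measurableType d) (R : realType)
  (mu : probability T R) (K : set (L0 mu)) (phi : L0 mu -> \bar R)
  (tau : set (set (L0 mu))) (F : set (L0 mu)) :
  measure_is_complete mu ->
  absolutely_convex K -> closed_in_prob K -> bounded_in_prob K ->
  convex_fun_on (EK K) phi -> proper_on (EK K) phi ->
  is_topology_on (EK K) tau -> locally_convex_on (EK K) tau ->
  equicontinuous_Koethe K tau -> Krein_Smulian K tau -> F_regular K F tau ->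
  [<-> lsc_on tau (EK K) phi;
       (forall f, EK K f ->
          phi f = ereal_sup [set ((pair f g)%:E - conjugate (EK K) phi g)%E | g in F]);
       equicontinuous_Fatou K phi].
Proof.
move=> _ cK clK bK cphi pphi top lc [cpt _] KS [ind reg]; tfae.
- move=> lsc f Kf; apply: conjugate_dual => //; first exact: pphi.1.
  move=> r rf.
  have [ell [lin cont le]] :=
    lsc_affine_minorant (span_subspace K) top lc cphi pphi lsc Kf rf.
  have [g [Fg ellg]] := reg _ lin cont; exists g => // h Kh.
  by rewrite -!ellg//; exact: le.
- exact: (conjugate_dual_Fatou cK clK cpt ind pphi.1).
- exact: (Fatou_lsc cK clK bK top ind KS cphi).
Qed.
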